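(* Assume that $A(S)\subseteq \mathrm{ri}(\mathrm{dom}\, g)$, that $\inf_{x\in S}F(x)>-\infty$, that $K(S)\subseteq \mathrm{ri}(\mathrm{dom}\, f)$, and that $r>0$ is such that $\mathcal K_r:=\{z\in\mathbb R^s: \mathrm{dist}(z,A(S))\le r\}\subseteq \mathrm{int}(\mathrm{dom}\, g)$; let $\ell_{g,\mathcal K_r}>0$ be a Lipschitz constant of $g$ on $\mathcal K_r$. Assume in addition that $g$ is essentially strictly convex and $\mathrm{int}(\mathrm{dom}\, f)\ne\emptyset$. Let $0<\gamma\le \frac{2r}{\ell_{g,\mathcal K_r}}$, $\|z^0\|\le \ell_{g,\mathcal K_r}$, $0<\varepsilon\le r$, and let $(x^k,y^k,z^k)_{k\ge0}$ be generated by the Adaptive DPFS algorithm (described in the context) with tolerance $\varepsilon$. Suppose that there exists $\theta\in[0,1)$ such that $\varpi$ (defined in the context) satisfies the Kurdyka-Łojasiewicz property at every $(x,y,z,u)\in\mathrm{dom}\,\partial\varpi$ with desingularization function $\phi(s)=\frac{\sigma}{1-\theta}s^{1-\theta}$ for some $\sigma>0$. Let $K_0$, $\varpi_k$ and $\underline\varpi$ be as in the context. Then: (i) if $\theta=0$, then $\varpi_k$ converges to $\underline\varpi$ in finite time as $k\to+\infty$ (i.e. $\varpi_k=\underline\varpi$ for all sufficiently large $k$); (ii) if $\theta\in(0,\frac12]$, then there exist $k_0\ge K_0+2$, $q\in(0,1)$ and $\kappa_1>0$ such that $0\le\varpi_k-\underline\varpi\le\kappa_1q^k$ for all $k\ge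 k_0$; (iii) if $\theta\in(\frac12,1)$, then there exist $k_0\ge K_0+2$ and $\kappa_2>0$ such that $0\le\varpi_k-\underline\varpi\le\kappa_2k^{-\frac1{2\theta-1}}$ for all $k\ge k_0+1$.
   Context: Setting. $S\subseteq\mathbb R^n$ is nonempty, convex and compact; $f:\mathbb R^p\to\mathbb R\cup\{\pm\infty\}$ and $g:\mathbb R^s\to\mathbb R\cup\{\pm\infty\}$ are proper, convex and lower semicontinuous; $A:\mathbb R^n\to\mathbb R^s$ and $K:\mathbb R^n\to\mathbb R^p$ are linear with adjoints $A^*,K^*$; $\varphi:\mathbb R^n\to\mathbb R$ is differentiable with $\ell_{\nabla\varphi}$-Lipschitz continuous gradient, $\ell_{\nabla\varphi}>0$. $F(x):=g(Ax)+\varphi(x)-f(Kx)$. $\sigma_A:=\|A\|^2$. $h^*$ denotes the Fenchel conjugate of $h$, $\mathrm{Proj}_S$ the projection onto $S$, $\iota_S$ the indicator function of $S$, $\mathrm{Prox}_{h,t}(w):=\arg\min_x\{h(x)+\frac1{2t}\|x-w\|^2\}$. A proper function is essentially strictly convex if it is strictly convex on every nonempty convex subset of the domain of its subdifferential. Adaptive DPFS. Parameters: $\gamma>0$, $0<\alpha<\frac\gamma2$, $\mu>0$, $\varepsilon>0$; a real sequence $(\beta_k)_{k\ge0}$ with $0<\underline\beta\le\beta_k\le\overline\beta<+\infty$ for all $k$; a reference sequence $(a_j)_{j\ge0}$ with $a_0=\alpha+\gamma$, $a_j\ge a_{j+1}>\alpha$, $\lim_j a_j=\alpha$, $\frac{a_j-a_{j+1}}{(a_{j+1}-\alpha)(a_j-\alpha)}\le\frac1\gamma$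 and $(a_j-\alpha)(a_{j+2}-\alpha)\ge(a_{j+1}-\alpha)^2$ for all $j\ge0$. Starting point $(x^0,y^0,z^0)\in\mathbb R^n\times\mathbb R^p\times\mathbb R^s$; $\alpha_0=a_0$. Throughout $\delta_k:=\frac{\alpha}{\alpha_k}$ and $\rho_k:=\frac{\ell_{\nabla\varphi}}2+\frac{3\sigma_A\gamma}{2(\alpha_k-\alpha)^2}+\mu$. For $k=0,1,2,\dots$: $x^{k+1}:=\mathrm{Proj}_S\big(x^k+\frac1{\rho_k}(-\nabla\varphi(x^k)+K^*y^k-A^*z^k)\big)$, $y^{k+1}:=\mathrm{Prox}_{f^*,1/\beta_k}(y^k+\frac1{\beta_k}Kx^{k+1})$, $z^{k+1}:=\mathrm{Prox}_{g^*,1/\alpha_k}(\delta_kz^k+\frac1{\alpha_k}Ax^{k+1})$; if $(\alpha_k-\alpha)\|z^{k+1}\|>\varepsilon$ then $\alpha_{k+1}$ is set to the next element of the reference sequence (i.e. $\alpha_{k+1}=a_{j+1}$ if $\alpha_k$ is the current element $a_j$); otherwise $\alpha_{k+1}:=\alpha_k$ (and the current element is unchanged). Under the stated assumptions there are $K_0\ge0$ and $\widetilde\alpha>\alpha$ with $\alpha_k=\widetilde\alpha$ and $(\alpha_k-\alpha)\|z^{k+1}\|\le\varepsilon$ for all $k\ge K_0$; fix such $K_0$. With this $\widetilde\alpha$, $$\varpi(x,y,z,u):=\langle z,Ax\rangle-g^*(z)+\varphi(x)+\iota_S(x)-\langle Kx,y\rangle+f^*(y)+\frac\alpha2\Big(1+\frac{4\alpha}{\widetilde\alpha-\alpha}\Big)\|z-u\|^2-\frac12(\widetilde\alpha-\alpha)\|z\|^2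 ,$$ $\varpi_k:=\varpi(x^k,y^k,z^k,z^{k-1})$ for $k\ge K_0+2$, and $\underline\varpi:=\lim_{k\to+\infty}\varpi_k\in\mathbb R$ (this limit exists). Subdifferential and KL property. For an extended-real-valued $h$ and $\bar w$ with $h(\bar w)\in\mathbb R$, the Fréchet subdifferential is $\widehat\partial h(\bar w)=\{v:\liminf_{w\to\bar w,w\ne\bar w}\frac{h(w)-h(\bar w)-\langle v,w-\bar w\rangle}{\|w-\bar w\|}\ge0\}$ and the limiting subdifferential $\partial h(\bar w)$ is the set of limits $v$ of sequences $v^k\in\widehat\partial h(w^k)$ with $w^k\to\bar w$, $h(w^k)\to h(\bar w)$; both are empty if $h(\bar w)\notin\mathbb R$. $\mathrm{dom}\,\partial h=\{w:\partial h(w)\neq\emptyset\}$; $\mathrm{dist}(0,\emptyset)=+\infty$. $h$ satisfies the Kurdyka-Łojasiewicz (KL) property at $\widehat w\in\mathrm{dom}\,\partial h$ with desingularization function $\phi$ if there are $\eta\in(0,+\infty]$ and an open neighborhood $U$ of $\widehat w$ such that $\phi:[0,\eta)\to[0,+\infty)$ is concave and continuous, $\phi(0)=0$, $\phi$ is continuously differentiable on $(0,\eta)$ with $\phi'>0$ there, and $\phi'(h(w)-h(\widehat w))\,\mathrm{dist}(0,\partial h(w))\ge1$ for all $w\in U$ with $h(\widehat w)<h(w)<h(\widehat w)+\eta$. For $h=\varpi$, the neighborhood $U$ is always taken inside $\mathbb R^n\times\mathbb R^p\times\mathrm{int}(\mathrm{dom}\, g^* )\times\mathbb R^s$, where $\varpi$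 is lower semicontinuous (one has $\mathrm{dom}\,\partial\varpi\subseteq\mathbb R^n\times\mathbb R^p\times\mathrm{int}(\mathrm{dom}\, g^* )\times\mathbb R^s$ when $g$ is essentially strictly convex). *)

(* Defs.v *)
From mathcomp Require Import all_boot all_order all_algebra.
From mathcomp Require Import all_classical all_reals all_analysis.
Import Order.TTheory GRing.Theory Num.Theory numFieldNormedType.Exports.

Set Implicit Arguments.
Unset Strict Implicit.
Unset Printing Implicit Defensive.

Local Open Scope classical_set_scope.
Local Open Scope ring_scope.

(* R^n is 'rV[R]_n.  A linear map A : R^m -> R^n is a matrix 'M[R]_(m, n)
   acting by x |-> x *m A, so that its adjoint is z |-> z *m A^T.  The library
   norm `|_| on 'rV[R]_n is the sup norm; it yields the usual topology, but
   the norm of the mathematics is the Euclidean [enorm]. *)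

Definition dot (R : realType) (n : nat) (u v : 'rV[R]_n) : R :=
  \sum_(i < n) u 0 i * v 0 i.

Definition enorm (R : realType) (n : nat) (u : 'rV[R]_n) : R :=
  Num.sqrt (dot u u).

Definition opnorm (R : realType) (m n : nat) (A : 'M[R]_(m, n)) : R :=
  sup [set enorm (x *m A) | x in [set x : 'rV[R]_m | enorm x <= 1]].

Definition grad (R : realType) (n : nat) (phi : 'rV[R]_n -> R)
    (x : 'rV[R]_n) : 'rV[R]_n :=
  \row_(i < n) ('d phi x) (delta_mx 0 i).

Local Open Scope ereal_scope.

(* dist(w, C) = +oo when C is empty *)
Definition edistance (R : realType) (n : nat) (w : 'rV[R]_n)
    (C : set 'rV[R]_n) : \bar R :=
  ereal_inf [set (enorm (w - c)%R)%:E | c in C].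

Definition affine_hull (R : realType) (n : nat) (C : set 'rV[R]_n) :
    set 'rV[R]_n :=
  [set y | exists (m : nat) (c : 'I_m -> R) (v : 'I_m -> 'rV[R]_n),
     [/\ forall i, C (v i), (\sum_(i < m) c i = 1)%R
       & y = (\sum_(i < m) c i *: v i)%R]].

Definition relative_interior (R : realType) (n : nat) (C : set 'rV[R]_n) :
    set 'rV[R]_n :=
  [set x | affine_hull C x /\ exists2 e : R, (0 < e)%R &
     forall y, affine_hull C y -> (enorm (y - x) < e)%R -> C y].

Definition effective_domain (R : realType) (n : nat) (h : 'rV[R]_n -> \bar R) :
    set 'rV[R]_n :=
  [set x | h x < +oo].

Definition proper_function (R : realType) (n : nat) (h : 'rV[R]_n -> \bar R) :=
  (forall x, h x != -oo) /\ effective_domain h !=set0.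

(* Only used for functions that do not take the value -oo, so that the
   right-hand side is never of the form (+oo) + (-oo). *)
Definition econvex (R : realType) (n : nat) (h : 'rV[R]_n -> \bar R) :=
  forall (x y : 'rV[R]_n) (t : R), (0 < t < 1)%R ->
    h (t *: x + (1 - t) *: y)%R <= t%:E * h x + (1 - t)%:E * h y.

Definition strictly_convex_on (R : realType) (n : nat)
    (h : 'rV[R]_n -> \bar R) (C : set 'rV[R]_n) :=
  forall (x y : 'rV[R]_n) (t : R), C x -> C y -> x != y -> (0 < t < 1)%R ->
    h (t *: x + (1 - t) *: y)%R < t%:E * h x + (1 - t)%:E * h y.

Definition fenchel_conjugate (R : realType) (n : nat)
    (h : 'rV[R]_n -> \bar R) (z : 'rV[R]_n) : \bar R :=
  ereal_sup [set (dot z x)%:E - h x | x in [set: 'rV[R]_n]].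

Definition indicator_function (R : realType) (n : nat) (S : set 'rV[R]_n)
    (x : 'rV[R]_n) : \bar R :=
  if x \in S then 0 else +oo.

Definition argmin (R : realType) (T : Type) (D : set T) (h : T -> \bar R) :
    set T :=
  [set x | D x /\ forall y, D y -> h x <= h y].

Definition metric_proj (R : realType) (n : nat) (S : set 'rV[R]_n)
    (w : 'rV[R]_n) : set 'rV[R]_n :=
  argmin S (fun x => (enorm (x - w)%R)%:E).

Definition prox (R : realType) (n : nat) (h : 'rV[R]_n -> \bar R) (t : R)
    (w : 'rV[R]_n) : set 'rV[R]_n :=
  argmin [set: 'rV[R]_n]
    (fun x => h x + ((2 * t)^-1 * enorm (x - w) ^+ 2)%R%:E).

Definition frechet_subdiff (R : realType) (n : nat) (h : 'rV[R]_n -> \bar R)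
    (wbar : 'rV[R]_n) : set 'rV[R]_n :=
  [set v | h wbar \is a fin_num /\
     0 <= limf_einf
       (fun w : 'rV[R]_n => (h w - h wbar - (dot v (w - wbar)%R)%:E)
                            * ((enorm (w - wbar))^-1)%R%:E) wbar^'].

Definition limiting_subdiff (R : realType) (n : nat) (h : 'rV[R]_n -> \bar R)
    (wbar : 'rV[R]_n) : set 'rV[R]_n :=
  [set v | h wbar \is a fin_num /\
     exists wk vk : nat -> 'rV[R]_n,
       [/\ forall k, frechet_subdiff h (wk k) (vk k),
           wk k @[k --> \oo] --> wbar,
           h (wk k) @[k --> \oo] --> h wbar
         & vk k @[k --> \oo] --> v]].

Definition subdiff_domain (R : realType) (n : nat) (h : 'rV[R]_n -> \bar R) :
    set 'rV[R]_n :=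
  [set w | limiting_subdiff h w !=set0].

Definition essentially_strictly_convex (R : realType) (n : nat)
    (h : 'rV[R]_n -> \bar R) :=
  forall C : set 'rV[R]_n, C !=set0 -> convex_set C ->
    C `<=` subdiff_domain h -> strictly_convex_on h C.

Definition desingularization (R : realType) (psi : R -> R) (eta : \bar R) :=
  [/\ (forall t : R, (0 <= t)%R -> t%:E < eta -> (0 <= psi t)%R),
      (forall u v t : R, (0 <= u)%R -> u%:E < eta -> (0 <= v)%R -> v%:E < eta ->
         (0 < t < 1)%R ->
         (t * psi u + (1 - t) * psi v <= psi (t * u + (1 - t) * v))%R),
      {within [set t : R | (0 <= t)%R /\ t%:E < eta], continuous psi},
      psi 0%R = 0%R
    & (forall t : R, (0 < t)%R -> t%:E < eta ->
         [/\ derivable psi t 1, {for t, continuous (derive1 psi)}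
           & (0 < derive1 psi t)%R])].

(* KL property of [h] at [what], the neighborhood being taken inside [D]. *)
Definition kl_property (R : realType) (n : nat) (D : set 'rV[R]_n)
    (h : 'rV[R]_n -> \bar R) (psi : R -> R) (what : 'rV[R]_n) :=
  subdiff_domain h what /\
  exists (eta : \bar R) (U : set 'rV[R]_n),
    [/\ 0 < eta, open U, U what, U `<=` D & desingularization psi eta] /\
    forall w, U w -> h what < h w -> h w < h what + eta ->
      1 <= (derive1 psi (fine (h w - h what)))%:E
           * edistance 0%R (limiting_subdiff h w).

Definition objective (R : realType) (n p s : nat)
    (g : 'rV[R]_s -> \bar R) (phi : 'rV[R]_n -> R) (f : 'rV[R]_p -> \bar R)
    (A : 'M[R]_(n, s)) (K : 'M[R]_(n, p)) (x : 'rV[R]_n) : \bar R :=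
  g (x *m A) + (phi x)%:E - f (x *m K).

(* Here (+oo) + (-oo) = -oo, hence varpi = -oo as soon as z is outside
   dom g^*.  The convention for such sums affects neither the subdifferentials
   (empty at points where varpi is infinite, and at z on the boundary of dom g^*
   the Frechet one is empty because of the nearby value -oo at the same x and y)
   nor the KL inequality, which only involves z in int(dom g^* ). *)
Definition varpi (R : realType) (n p s : nat) (S : set 'rV[R]_n)
    (f : 'rV[R]_p -> \bar R) (g : 'rV[R]_s -> \bar R) (phi : 'rV[R]_n -> R)
    (A : 'M[R]_(n, s)) (K : 'M[R]_(n, p)) (alpha alphat : R)
    (x : 'rV[R]_n) (y : 'rV[R]_p) (z u : 'rV[R]_s) : \bar R :=
  (dot z (x *m A))%:E - fenchel_conjugate g z + (phi x)%:E
  + indicator_function S x - (dot (x *m K) y)%:E + fenchel_conjugate f y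
  + (alpha / 2 * (1 + 4 * alpha / (alphat - alpha)) * enorm (z - u) ^+ 2)%R%:E
  - (1 / 2 * (alphat - alpha) * enorm z ^+ 2)%R%:E.

(* A function on R^n x R^p x R^s x R^s seen on R^(n + (p + (s + s))); the
   identification preserves the inner product [dot]. *)
Definition uncurry4 (R : realType) (n p s : nat)
    (h : 'rV[R]_n -> 'rV[R]_p -> 'rV[R]_s -> 'rV[R]_s -> \bar R)
    (w : 'rV[R]_(n + (p + (s + s)))) : \bar R :=
  h (lsubmx w) (lsubmx (rsubmx w)) (lsubmx (rsubmx (rsubmx w)))
    (rsubmx (rsubmx (rsubmx w))).

Definition third_block_in (R : realType) (n p s : nat) (D : set 'rV[R]_s) :
    set 'rV[R]_(n + (p + (s + s))) :=
  [set w | D (lsubmx (rsubmx (rsubmx w)))].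

Local Close Scope ereal_scope.

Record reference_sequence (R : realType) (alpha gamma : R) (a : nat -> R) :
    Prop := ReferenceSequence {
  ref_init : a 0%N = alpha + gamma;
  ref_bounds : forall j, alpha < a j.+1 <= a j;
  ref_lim : a j @[j --> \oo] --> alpha;
  ref_step : forall j,
    (a j - a j.+1) / ((a j.+1 - alpha) * (a j - alpha)) <= gamma^-1;
  ref_logconvex : forall j,
    (a j.+1 - alpha) ^+ 2 <= (a j - alpha) * (a j.+2 - alpha) }.

(* [idx k] is the position in the reference sequence of the current element at
   iteration k.  The projection and the proximal points are unique, so
   membership in the corresponding argmin sets is the assignment. *)
Record adaptive_dpfs (R : realType) (n p s : nat) (S : set 'rV[R]_n)
    (f : 'rV[R]_p -> \bar R) (g : 'rV[R]_s -> \bar R) (phi : 'rV[R]_n -> R)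
    (A : 'M[R]_(n, s)) (K : 'M[R]_(n, p))
    (lphi alpha gamma mu eps : R) (beta a : nat -> R)
    (idx : nat -> nat) (alphas : nat -> R)
    (x : nat -> 'rV[R]_n) (y : nat -> 'rV[R]_p) (z : nat -> 'rV[R]_s) :
    Prop := AdaptiveDPFS {
  dpfs_idx0 : idx 0%N = 0%N;
  dpfs_alphas : forall k, alphas k = a (idx k);
  dpfs_x : forall k,
    let rho := lphi / 2
      + 3 * opnorm A ^+ 2 * gamma / (2 * (alphas k - alpha) ^+ 2) + mu in
    metric_proj S
      (x k + rho^-1 *: (- grad phi (x k) + y k *m K^T - z k *m A^T)) (x k.+1);
  dpfs_y : forall k,
    prox (fenchel_conjugate f) (beta k)^-1
      (y k + (beta k)^-1 *: (x k.+1 *m K)) (y k.+1);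
  dpfs_z : forall k,
    let delta := alpha / alphas k in
    prox (fenchel_conjugate g) (alphas k)^-1
      (delta *: z k + (alphas k)^-1 *: (x k.+1 *m A)) (z k.+1);
  dpfs_idxS : forall k,
    idx k.+1 =
      if eps < (alphas k - alpha) * enorm (z k.+1) then (idx k).+1 else idx k }.

Definition stabilized (R : realType) (s : nat) (alpha eps : R)
    (alphas : nat -> R) (z : nat -> 'rV[R]_s) (K0 : nat) (alphat : R) :=
  alpha < alphat /\
  forall k, (K0 <= k)%N ->
    alphas k = alphat /\ (alphas k - alpha) * enorm (z k.+1) <= eps.

(* Main.v *)
(** A proximal point of a conjugate [h^*] is a subgradient of [h] (Moreau
    decomposition), so [z^{k+1}] is a subgradient of [g], and in fact the
    gradient of a Moreau envelope of [g] at a point of [K_r]; this bounds [z^k]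
    by the Lipschitz constant and forces the reference sequence to stop moving.
    From then on [varpi] decreases at each step by at least a multiple of the
    squared step length, the cross terms in [z] being absorbed by the
    monotonicity of the subdifferential of [g^*].  Essential strict convexity
    of [g] makes [g^*] Frechet differentiable wherever it is subdifferentiable,
    hence [-g^*] and then [varpi] have Frechet subgradients at the iterates,
    bounded by the step length.  The iterates are bounded and their cluster
    points are critical with value [lim varpi_k], so the KL inequality holds
    along the tail of the sequence with one constant, and
    [e_k = varpi_k - lim varpi_k] satisfies
    [e_{k+1}^(2 theta) <= C (e_k - e_{k+1})], which yields the three rates. *)

Require Import Defs.
From mathcomp Require Import all_boot all_order all_algebra.
From mathcomp Require Import all_classical all_reals all_analysis.
From mathcomp Require Import ring lra zify.
Import Order.TTheory GRing.Theory Num.Theory numFieldNormedType.Exports.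

Set Implicit Arguments.
Unset Strict Implicit.
Unset Printing Implicit Defensive.

Local Open Scope classical_set_scope.
Local Open Scope ring_scope.

(** * The Euclidean norm *)

(** The obstacle is the concave term [-g^*]: because of it [varpi] is not convex in [z], and it need
    not be lower semicontinuous where a cluster point of [z^k] might lie on the boundary of the
    domain of [g^*]. The calculus of conjugates is therefore avoided. At the iterates a conjugate
    value is read off from the Fenchel-Young equality [h^*(u) = <u, p> - h(p)], where [p] is the
    primal point delivered by the proximal step, and limits of such values follow from the lower
    semicontinuity of [f] and [g] themselves ([esubgrad_closed]). A Frechet subgradient of [-g^*]
    asks only for an upper first-order bound on [g^*], which is what [conjugate_upper_diff] proves.
    The projection bounds [x^k] and the Lipschitz constant bounds [z^k], but nothing in the
    algorithm bounds [y^k] directly. Its bound comes from the compactness of [K(S)] inside the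
    interior of the domain of [f], which makes [f^*(y) - <Kx, y>] coercive in [y] uniformly in
    [x]. *)

Section Euclidean.
Context {R : realType}.

Lemma dotE n (u v : 'rV[R]_n) : dot u v = (u *m v^T) 0 0.
Proof. by rewrite mxE; apply: eq_bigr => i _; rewrite mxE. Qed.

Lemma dotC n (u v : 'rV[R]_n) : dot u v = dot v u.
Proof. by apply: eq_bigr => i _; rewrite mulrC. Qed.

Lemma dotDl n (u v w : 'rV[R]_n) : dot (u + v) w = dot u w + dot v w.
Proof. by rewrite !dotE mulmxDl mxE. Qed.

Lemma dotDr n (u v w : 'rV[R]_n) : dot w (u + v) = dot w u + dot w v.
Proof. by rewrite dotC dotDl !(dotC w). Qed.

Lemma dotNl n (u w : 'rV[R]_n) : dot (- u) w = - dot u w.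
Proof. by rewrite !dotE mulNmx mxE. Qed.

Lemma dotNr n (u w : 'rV[R]_n) : dot w (- u) = - dot w u.
Proof. by rewrite dotC dotNl (dotC w). Qed.

Lemma dotZl n (u w : 'rV[R]_n) t : dot (t *: u) w = t * dot u w.
Proof. by rewrite !dotE -scalemxAl mxE. Qed.

Lemma dotZr n (u w : 'rV[R]_n) t : dot w (t *: u) = t * dot w u.
Proof. by rewrite dotC dotZl (dotC w). Qed.

Lemma dot0l n (w : 'rV[R]_n) : dot 0 w = 0.
Proof. by rewrite -(scale0r 0) dotZl mul0r. Qed.

Lemma dot0r n (w : 'rV[R]_n) : dot w 0 = 0.
Proof. by rewrite dotC dot0l. Qed.

Definition dot_lin := (dotDl, dotDr, dotNl, dotNr, dotZl, dotZr).

Lemma dot_mulmx n m (B : 'M[R]_(n, m)) (u : 'rV[R]_n) (w : 'rV[R]_m) :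
  dot (u *m B) w = dot u (w *m B^T).
Proof. by rewrite !dotE trmx_mul trmxK mulmxA. Qed.

Lemma dot_row_mx n m (u u' : 'rV[R]_n) (w w' : 'rV[R]_m) :
  dot (row_mx u w) (row_mx u' w') = dot u u' + dot w w'.
Proof. by rewrite !dotE tr_row_mx mul_row_col mxE. Qed.

Lemma dot_ge0 n (u : 'rV[R]_n) : 0 <= dot u u.
Proof. by apply: sumr_ge0 => i _; rewrite -expr2 sqr_ge0. Qed.

Lemma dot_eq0 n (u : 'rV[R]_n) : (dot u u == 0) = (u == 0).
Proof.
apply/eqP/eqP => [|->]; last exact: dot0l.
move/psumr_eq0P => H; apply/rowP => i; rewrite mxE; apply/eqP.
by rewrite -sqrf_eq0 expr2 H// => j _; rewrite -expr2 sqr_ge0.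
Qed.

Lemma sqr_enorm n (u : 'rV[R]_n) : enorm u ^+ 2 = dot u u.
Proof. by rewrite /enorm sqr_sqrtr// dot_ge0. Qed.

Lemma enorm_ge0 n (u : 'rV[R]_n) : 0 <= enorm u.
Proof. exact: sqrtr_ge0. Qed.

Lemma enorm0 n : enorm (0 : 'rV[R]_n) = 0.
Proof. by rewrite /enorm dot0l sqrtr0. Qed.

Lemma enorm_eq0 n (u : 'rV[R]_n) : (enorm u == 0) = (u == 0).
Proof. by rewrite -dot_eq0 -sqr_enorm sqrf_eq0. Qed.

Lemma enorm_gt0 n (u : 'rV[R]_n) : (0 < enorm u) = (u != 0).
Proof. by rewrite lt_def enorm_eq0 enorm_ge0 andbT. Qed.

Lemma enormZ n (u : 'rV[R]_n) t : enorm (t *: u) = `|t| * enorm u.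
Proof.
rewrite /enorm !dot_lin mulrA -expr2 sqrtrM ?sqr_ge0// sqrtr_sqr.
by [].
Qed.

Lemma enormN n (u : 'rV[R]_n) : enorm (- u) = enorm u.
Proof. by rewrite -scaleN1r enormZ normrN1 mul1r. Qed.

Lemma enormB n (u v : 'rV[R]_n) : enorm (u - v) = enorm (v - u).
Proof. by rewrite -enormN opprB. Qed.

Lemma dot_le n (u v : 'rV[R]_n) : dot u v <= enorm u * enorm v.
Proof.
have [->|u0] := eqVneq u 0; first by rewrite dot0l enorm0 mul0r.
have [->|v0] := eqVneq v 0; first by rewrite dot0r enorm0 mulr0.
have eu : 0 < enorm u by rewrite enorm_gt0.
have ev : 0 < enorm v by rewrite enorm_gt0.
(* Expanding this square and dividing by both norms is the Cauchy-Schwarz inequality. *)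
have := dot_ge0 (enorm v *: u - enorm u *: v).
rewrite !dot_lin -!sqr_enorm (dotC v u) => H.
rewrite -(ler_pM2l (mulr_gt0 eu ev)); nra.
Qed.

Lemma norm_dot_le n (u v : 'rV[R]_n) : `|dot u v| <= enorm u * enorm v.
Proof.
by rewrite ler_norml dot_le andbT -(enormN u) lerNl -dotNl dot_le.
Qed.

Lemma enormD_le n (u v : 'rV[R]_n) : enorm (u + v) <= enorm u + enorm v.
Proof.
have := enorm_ge0 u; have := enorm_ge0 v => v0 u0.
rewrite -(@ler_pXn2r _ 2)// ?nnegrE ?addr_ge0 ?enorm_ge0//.
rewrite sqr_enorm !dot_lin -!sqr_enorm (dotC v u).
have := dot_le u v; nra.
Qed.

Lemma enormB_le n (u v : 'rV[R]_n) : enorm (u - v) <= enorm u + enorm v.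
Proof. by rewrite (le_trans (enormD_le _ _))// enormN. Qed.

Lemma enorm_coord n (u : 'rV[R]_n) i : `|u 0 i| <= enorm u.
Proof.
rewrite -(sqrtr_sqr (u 0 i)) /enorm ler_sqrt ?dot_ge0// /dot (bigD1 i)//=.
by rewrite -expr2 lerDl sumr_ge0// => j _; rewrite -expr2 sqr_ge0.
Qed.

Lemma norm_coord n (u : 'rV[R]_n) i : `|u 0 i| <= `|u|.
Proof.
rewrite [leRHS]/Num.norm/= mx_normrE.
by apply/bigmax_geP; right; exists (0, i).
Qed.

Lemma norm_le_enorm n (u : 'rV[R]_n) : `|u| <= enorm u.
Proof.
rewrite [leLHS]/Num.norm/= mx_normrE; apply/bigmax_leP; split => [|[a i] _].
  exact: enorm_ge0.
by rewrite ord1 enorm_coord.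
Qed.

(** The sharp constant is the square root of [n]; [n + 1] is cruder but positive for [n = 0] too, so
    that it can be divided by. *)
Lemma enorm_le_norm n (u : 'rV[R]_n) : enorm u <= (n%:R + 1) * `|u|.
Proof.
have n0 : (0 : R) <= n%:R by rewrite ler0n.
rewrite -(@ler_pXn2r _ 2) ?nnegrE ?enorm_ge0 ?mulr_ge0 ?addr_ge0//.
rewrite sqr_enorm exprMn; apply: (@le_trans _ _ (n%:R * `|u| ^+ 2)).
  rewrite /dot mulr_natl -[X in _ <= _ *+ X](card_ord n) -sumr_const.
  apply: ler_sum => i _; rewrite -expr2 -real_normK ?num_real//.
  by rewrite ler_pXn2r ?nnegrE// norm_coord.
apply: ler_wpM2r; first by rewrite sqr_ge0.
nra.
Qed.

End Euclidean.

(** * Topology, compactness and linear maps in terms of the Euclidean norm *)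

Section Topology.
Context {R : realType}.

(** Neighborhoods are defined by the sup norm; through this equivalence every topological argument
    below can use [enorm] alone. *)
Lemma nbhs_enormP n (u : 'rV[R]_n) (D : set 'rV[R]_n) :
  nbhs u D <-> exists2 e : R, 0 < e & forall v, enorm (v - u) < e -> D v.
Proof.
split=> [/nbhs_ballP[e /= e0 eD]|[e e0 eD]].
  exists e => // v uv; apply: eD; rewrite -ball_normE/= distrC.
  exact: le_lt_trans (norm_le_enorm _) uv.
have n0 : (0 : R) < n%:R + 1 by rewrite ltr_wpDl.
apply/nbhs_ballP; exists (e / (n%:R + 1)); first exact: divr_gt0.
move=> v; rewrite -ball_normE/= distrC ltr_pdivlMr// mulrC => uv; apply: eD.
exact: le_lt_trans (enorm_le_norm _) uv.
Qed.

Lemma cvg_enormP n T (F : set_system T) {FF : Filter F} (u : T -> 'rV[R]_n) (l : 'rV[R]_n) :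
  u @ F --> l <-> enorm (u t - l) @[t --> F] --> (0 : R).
Proof.
split=> [ul|ul].
  apply: (iffRL (@cvgr0Pnorm_lt R R^o T F FF _)) => e e0.
  have : nbhs l [set v | enorm (v - l) < e] by apply: (iffRL (nbhs_enormP _ _)); exists e.
  by move=> /ul Fu; apply: (@filterS _ F _ _ _ _ Fu) => t /=; rewrite ger0_norm ?enorm_ge0.
move=> D /nbhs_enormP[e e0 eD].
have := @cvgr0_norm_lt R R^o T F FF _ ul e e0 => Fu; apply: filterS Fu => t /=.
by rewrite ger0_norm ?enorm_ge0//; exact: eD.
Qed.

Lemma cvg_dot n T (F : set_system T) {FF : Filter F} (u v : T -> 'rV[R]_n) (a b : 'rV[R]_n) :
  u @ F --> a -> v @ F --> b -> dot (u t) (v t) @[t --> F] --> dot a b.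
Proof.
move=> ua vb; rewrite /dot; apply: (cvg_big add_continuous) => i _; apply: cvgM.
  exact: (@cvg_comp _ _ _ u (fun w => w 0 i) F (nbhs a) _ ua (@coord_continuous _ _ _ 0 i a)).
exact: (@cvg_comp _ _ _ v (fun w => w 0 i) F (nbhs b) _ vb (@coord_continuous _ _ _ 0 i b)).
Qed.

Lemma cvg_enorm n T (F : set_system T) {FF : Filter F} (u : T -> 'rV[R]_n) (a : 'rV[R]_n) :
  u @ F --> a -> enorm (u t) @[t --> F] --> enorm a.
Proof.
move=> ua; exact: (@cvg_comp _ _ _ (fun t => dot (u t) (u t)) (@Num.sqrt R) F _ _
  (cvg_dot ua ua) (@sqrt_continuous R (dot a a))).
Qed.

(** This has to precede any use of [opnorm]: [sup] dominates its set only once that set is known to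
    be bounded above. *)
Lemma mulmx_bounded n m (B : 'M[R]_(n, m)) :
  exists2 c : R, 0 <= c & forall u, enorm (u *m B) <= c * enorm u.
Proof.
pose c := \sum_(j < m) enorm (col j B)^T.
have c0 : 0 <= c by apply: sumr_ge0 => j _; exact: enorm_ge0.
exists ((m%:R + 1) * c) => [|u]; first by rewrite mulr_ge0// addr_ge0.
apply: (le_trans (enorm_le_norm _)); rewrite -mulrA ler_wpM2l ?addr_ge0//.
rewrite [leLHS]/Num.norm/= mx_normrE; apply/bigmax_leP.
split => [|[a j] _ /=]; first by rewrite mulr_ge0 ?enorm_ge0.
have -> : (u *m B) a j = dot u (col j B)^T.
  by rewrite ord1 mxE; apply: eq_bigr => i _; rewrite !mxE.
apply: (le_trans (norm_dot_le _ _)); rewrite mulrC ler_wpM2r ?enorm_ge0//.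
by rewrite /c (bigD1 j)//= lerDl sumr_ge0// => i _; exact: enorm_ge0.
Qed.

Lemma enorm_mulmx_le n m (B : 'M[R]_(n, m)) u :
  enorm (u *m B) <= opnorm B * enorm u.
Proof.
have [->|u0] := eqVneq u 0; first by rewrite mul0mx !enorm0 mulr0.
have eu : 0 < enorm u by rewrite enorm_gt0.
rewrite -ler_pdivrMr//; have [c c0 Bc] := mulmx_bounded B.
have -> : enorm (u *m B) / enorm u = enorm ((enorm u)^-1 *: u *m B).
  by rewrite -scalemxAl enormZ ger0_norm ?invr_ge0 ?enorm_ge0// mulrC.
apply: ub_le_sup.
  exists c => _ [v /= v1 <-]; apply: (le_trans (Bc _)).
  by rewrite -[leRHS]mulr1 ler_wpM2l.
exists ((enorm u)^-1 *: u) => //=.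
by rewrite enormZ ger0_norm ?invr_ge0 ?enorm_ge0// mulVf// gt_eqF.
Qed.

Lemma cvg_mulmx n m (B : 'M[R]_(n, m)) T (F : set_system T) {FF : Filter F}
  (u : T -> 'rV[R]_n) (a : 'rV[R]_n) : u @ F --> a -> (u t *m B) @[t --> F] --> a *m B.
Proof.
move=> /cvg_enormP ua; apply/cvg_enormP.
have [c c0 Bc] := mulmx_bounded B.
apply: (@squeeze_cvgr _ _ _ _ (fun=> 0) (fun t => c * enorm (u t - a))).
- by apply: nearW => t; rewrite -mulmxBl enorm_ge0 Bc.
- exact: cvg_cst.
- by rewrite -(mulr0 c); apply: cvgM => //; exact: cvg_cst.
Qed.

Lemma cvg_squeeze0 n (u : nat -> 'rV[R]_n) (a : 'rV[R]_n) (c : nat -> R) :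
  (\forall k \near \oo, enorm (u k - a) <= c k) ->
  c @ \oo --> (0 : R) -> u @ \oo --> a.
Proof.
move=> uc c0; apply/cvg_enormP.
apply: (@squeeze_cvgr _ _ _ _ (fun=> 0) c) => //; last exact: cvg_cst.
by apply: filterS uc => k ->; rewrite enorm_ge0.
Qed.

Lemma compact_enorm_le n (M : R) (w : 'rV[R]_n) :
  compact [set u | enorm (u - w) <= M].
Proof.
apply: bounded_closed_compact.
  exists (M + enorm w); split; first exact: num_real.
  move=> N MN u /= uw; apply: (le_trans (norm_le_enorm _)).
  rewrite -(subrK w u); apply: (le_trans (enormD_le _ _)).
  by apply: le_trans (ltW MN); rewrite lerD2r.
have -> : [set u | enorm (u - w) <= M] =
    (fun u => enorm (u - w)) @^-1` [set t | t <= M] by [].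
apply: closed_comp => [u _|]; last exact: closed_le.
apply: (@cvg_enorm _ _ (nbhs u) _ (fun u => u - w)).
by apply: cvgB; [exact: cvg_id|exact: cvg_cst].
Qed.

Lemma compact_enorm_bounded n (D : set 'rV[R]_n) : compact D ->
  exists M : R, 0 <= M /\ forall u, D u -> enorm u <= M.
Proof.
move=> /compact_bounded[M [_ MP]].
have n0 : (0 : R) <= n%:R + 1 by rewrite addr_ge0.
have MD u : D u -> `|u| <= `|M| + 1.
  by move=> Du; apply: MP => //; rewrite ltr_pwDr// ler_norm.
exists ((n%:R + 1) * (`|M| + 1)); split; first by rewrite mulr_ge0// addr_ge0.
by move=> u /MD uM; apply: (le_trans (enorm_le_norm _)); rewrite ler_wpM2l.
Qed.

(** Asking [k <= e k] instead of strict monotonicity spares a recursive choice and is enough for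
    limits to pass to [e] ([cvg_subseq]). *)
Lemma bounded_subsequence n (M : R) (u : nat -> 'rV[R]_n) :
  (forall k, enorm (u k) <= M) ->
  exists (a : 'rV[R]_n) (e : nat -> nat),
    (forall k, (k <= e k)%N) /\ u (e k) @[k --> \oo] --> a.
Proof.
move=> uM.
have [|a [_ ca]] := @compact_enorm_le n M 0 (u @ \oo) _.
  by exists 0%N => // k _ /=; rewrite subr0.
have P k : exists j, (k <= j)%N /\ enorm (u j - a) < k.+1%:R^-1.
  have /ca : (u @ \oo) [set u j | j in [set j | (k <= j)%N]].
    by exists k => // j kj; exists j.
  have : nbhs a [set v | enorm (v - a) < k.+1%:R^-1].
    by apply: (iffRL (nbhs_enormP _ _)); exists k.+1%:R^-1 => //; rewrite invr_gt0.
  by move=> /[swap] /[apply] -[_ [[j /= kj <-] ja]]; exists j.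
have /choice[e eP] := P.
exists a, e; split=> [k|]; first by have [] := eP k.
apply: (@cvg_squeeze0 _ _ _ (fun k => k.+1%:R^-1)); last exact: cvg_harmonic.
by apply: nearW => k; apply: ltW; have [] := eP k.
Qed.

Lemma cvg_subseq (T : topologicalType) (v : nat -> T) (e : nat -> nat) (l : T) :
  (forall k, (k <= e k)%N) -> v @ \oo --> l -> v (e k) @[k --> \oo] --> l.
Proof.
move=> ek vl; apply: cvg_comp vl => D [N _ ND].
by exists N => // k /= Nk; apply: ND => /=; exact: leq_trans (ek k).
Qed.

End Topology.

(** * Convex functions, proximal points and conjugates *)

(** The filter [F] of sets containing a whole sublevel part of [D] plays the role of a minimizing
    sequence. Without a minimizer, each [x] has a neighborhood on which [h] exceeds the value at
    some better point; compactness then gives one [y0] in [D] strictly below all of [D], hence below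
    itself. *)
Lemma lsc_attains_min (R : realType) (X : topologicalType) (h : X -> \bar R)
    (D : set X) : compact D -> D !=set0 -> lower_semicontinuous h ->
  exists2 x, D x & forall y, D y -> (h x <= h y)%E.
Proof.
move=> cD [d0 Dd0] lsch.
apply: contrapT => nomin.
have lt_in x : D x -> exists2 y, D y & (h y < h x)%E.
  move=> Dx; apply: contrapT => noy; apply: nomin; exists x => // y Dy.
  by rewrite leNgt; apply/negP => yx; apply: noy; exists y.
pose F : set_system X := [set Q | exists2 y0, D y0 &
  forall y, D y -> (h y <= h y0)%E -> Q y].
have FF : Filter F.
  split; first by exists d0.
    move=> P Q [a Da aP] [b Db bQ].
    have [ab|ba] := leP (h a) (h b).
      exists a => // y Dy ya; split; first exact: aP.
      by apply: bQ => //; exact: le_trans ab.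
    exists b => // y Dy yb; split; last exact: bQ.
    by apply: aP => //; apply: le_trans (ltW ba).
  by move=> P Q PQ [a Da aP]; exists a => // y Dy ya; apply: PQ; exact: aP.
have [|y0 Dy0 y0P] :=
    (compact_near_coveringP D).1 cD X F (fun y x => (h y < h x)%E) FF.
  move=> x Dx; have [y Dy yx] := lt_in x Dx.
  have [b yb bx] : exists2 b : R, (h y <= b%:E)%E & (b%:E < h x)%E.
    case: (h y) yx => [b| |]; first by exists b.
      by rewrite ltNge leey.
    case: (h x) => [b _|_|//]; last by exists 0; rewrite ?leNye ?ltry.
    by exists (b - 1); rewrite ?leNye// lte_fin ltrBlDr ltrDl.
  have [V Vx Vb] := lsch x b bx.
  exists (V, [set y' | (h y' <= b%:E)%E]) => /=; last first.
    by move=> [x' y'] [/= /Vb bx' y'b]; exact: le_lt_trans bx'.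
  split => //; exists y => // y' _ y'y; exact: le_trans yb.
by have := y0P y0 Dy0 (lexx _) _ Dy0; rewrite /= ltxx.
Qed.

Lemma lsc_add_continuous (R : realType) (X : topologicalType)
    (h : X -> \bar R) (c : X -> R) :
  lower_semicontinuous h -> continuous c ->
  lower_semicontinuous (fun x => h x + (c x)%:E)%E.
Proof.
move=> lsch cc x a ax.
have [b bh ab] : exists2 b : R, (b%:E < h x)%E & a < b + c x.
  case: (h x) ax => [r| |//].
    rewrite -EFinD lte_fin => arc; exists ((a - c x + r) / 2).
      by rewrite lte_fin; lra.
    lra.
  by exists (a - c x + 1); [rewrite ltry|lra].
have [V Vx Vb] := lsch x b bh.
have abx : a - b < c x by lra.
exists (V `&` [set y | a - b < c y]) => [|y [/Vb by' /= aby]].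
  by apply: filterI => //; exact: (cc x _ (lt_nbhsr abx)).
case: (h y) by' => [r|_|//]; last by rewrite addye// ltry.
by rewrite -EFinD !lte_fin; lra.
Qed.

Section ConvexFunctions.
Context {R : realType} {n : nat}.
Implicit Types (h : 'rV[R]_n -> \bar R) (u v w p q : 'rV[R]_n).

Lemma econvex_le h p q (a b t : R) : econvex h -> 0 < t < 1 ->
  (h p <= a%:E)%E -> (h q <= b%:E)%E ->
  (h (t *: p + (1 - t) *: q)%R <= (t * a + (1 - t) * b)%R%:E)%E.
Proof.
move=> ch /andP[t0 t1] pa qb; have := ch p q t; rewrite t0 t1 => /(_ isT).
move=> /le_trans; apply; rewrite [leRHS]EFinD [X in (_ <= X + _)%E]EFinM [X in (_ <= _ + X)%E]EFinM.
by apply: leeD; apply: lee_wpmul2l => //; rewrite lee_fin ?subr_ge0 ltW.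
Qed.

(** The subgradient of convex analysis: a global affine minorant, in contrast with the local liminf
    of [frechet_subdiff]. *)
Definition esubgrad h u p :=
  h p \is a fin_num /\ forall q, (h p + (dot u (q - p)%R)%:E <= h q)%E.

Lemma esubgradP h u p : esubgrad h u p <->
  exists2 b : R, h p = b%:E & forall q, ((b + dot u (q - p))%R%:E <= h q)%E.
Proof.
split=> [[/fineK hp H]|[b hp H]].
  by exists (fine (h p)) => // q; rewrite EFinD hp.
by split=> [|q]; rewrite hp// -EFinD.
Qed.

Lemma fenchel_conjugate_ge h u q :
  ((dot u q)%:E - h q <= fenchel_conjugate h u)%E.
Proof. by apply: ereal_sup_ubound; exists q. Qed.

(** The equality case of the Fenchel-Young inequality; it turns conjugate values into real numbers
    computed from [h]. *)
Lemma esubgrad_conjugate h u p (b : R) : esubgrad h u p -> h p = b%:E ->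
  fenchel_conjugate h u = (dot u p - b)%:E.
Proof.
move=> /esubgradP[b' hp H]; rewrite hp => -[<-]{b}; apply/eqP; rewrite eq_le; apply/andP; split.
  apply: ge_ereal_sup => _ [q _ <-]; have := H q.
  case: (h q) => [r| |//]; last by rewrite addeNy leNye.
  by rewrite -EFinB !lee_fin !dot_lin; lra.
by have := fenchel_conjugate_ge h u p; rewrite hp.
Qed.

(** When [u] is a subgradient of [h] at [p], [dot u p - b] is the value of the conjugate at [u], so
    this says that [p] is a subgradient of the conjugate at [u]. *)
Lemma fenchel_conjugate_ge_affine h u v p (b : R) : h p = b%:E ->
  ((dot u p - b + dot p (v - u))%:E <= fenchel_conjugate h v)%E.
Proof.
move=> hp; apply: le_trans (fenchel_conjugate_ge h v p).
by rewrite hp lee_fin !dot_lin (dotC p v) (dotC p u); lra.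
Qed.

(** A substitute for an affine minorant, obtained from a local upper bound without any separation
    theorem. It excludes the value [-oo] and makes [h] plus a squared distance coercive. *)
Definition cone_minorized h :=
  exists c0 C : R, 0 <= C /\ forall q, ((c0 - C * enorm q)%:E <= h q)%E.

Lemma cone_minorized_gtNy h q : cone_minorized h -> (-oo < h q)%E.
Proof. by move=> [c0 [C [_ H]]]; apply: lt_le_trans (H q); rewrite ltNyr. Qed.

(* [w0] lies between any [q] and a point of the ball, so convexity transfers
   the upper bound [M] on the ball to a lower bound at [q]. *)
Lemma bounded_above_cone_minorized h w0 (d M : R) :
  econvex h -> (forall q, h q != -oo%E) -> 0 < d ->
  (forall q, enorm (q - w0) <= d -> (h q <= M%:E)%E) -> cone_minorized h.
Proof.
move=> ch hNy d0 hM.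
have [b hb] : exists b, h w0 = b%:E.
  have := hM w0; rewrite subrr enorm0 => /(_ (ltW d0)).
  by have := hNy w0; case: (h w0) => // b; exists b.
have bM : b <= M.
  by have := hM w0; rewrite subrr enorm0 hb lee_fin; apply; exact: ltW.
pose C := (M - b) / d.
have C0 : 0 <= C by rewrite divr_ge0 ?subr_ge0// ltW.
exists (b - C * enorm w0), C; split=> // q.
have [qw|qw] := eqVneq q w0.
  rewrite qw hb lee_fin; have := enorm_ge0 w0; nra.
pose s := enorm (q - w0).
have s0 : 0 < s by rewrite enorm_gt0 subr_eq0.
have sE : s <= enorm q + enorm w0 by exact: enormB_le.
case hqE : (h q) => [e| |]; first last.
- by have := hNy q; rewrite hqE.
- by rewrite leey.
(* With this weight [w0] is the convex combination of [q] and of the point at distance [d] from [w0]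
   on the opposite side. *)
pose t := s / (s + d).
have sd : 0 < s + d by rewrite addr_gt0.
have t01 : 0 < t < 1 by rewrite divr_gt0//= /t ltr_pdivrMr// mul1r ltrDl.
have pM : (h (w0 - (d / s) *: (q - w0))%R <= M%:E)%E.
  apply: hM; rewrite addrC addrA addNr add0r enormN enormZ ger0_norm.
    by rewrite -/s divfK// gt_eqF.
  by rewrite divr_ge0// ltW.
have := @econvex_le h (w0 - (d / s) *: (q - w0)) q M e t ch t01 pM.
have -> : t *: (w0 - (d / s) *: (q - w0)) + (1 - t) *: q = w0.
  apply/rowP => i; rewrite !mxE /t; field.
  by rewrite !gt_eqF.
rewrite hb hqE !lee_fin lexx => /(_ isT).
have -> : t * M + (1 - t) * e = (s * M + d * e) / (s + d).
  by rewrite /t; field; rewrite gt_eqF.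
rewrite ler_pdivlMr// => bsd.
have Cd : C * d = M - b by rewrite /C divfK// gt_eqF.
have Cs : C * s <= C * (enorm q + enorm w0) by rewrite ler_wpM2l.
suff : b - C * s <= e by lra.
rewrite -(ler_pM2r d0); nra.
Qed.

(** Lets [t] tend to 0. The optimality conditions of proximal points and of projections come from
    comparing values along a segment and dividing by [t]. *)
Lemma le_of_small_slope (a b c : R) :
  (forall t, 0 < t < 1 -> a <= b + t * c) -> a <= b.
Proof.
move=> H; apply/ler_addgt0Pr => e e0.
pose t := Num.min (1 / 2) (e / (`|c| + 1)).
have c1 : 0 < `|c| + 1 by rewrite ltr_wpDl.
have t0 : 0 < t by rewrite lt_min divr_gt0//= divr_gt0.
have t1 : t < 1 by rewrite gt_min; apply/orP; left; lra.
apply: (le_trans (H t _)); first by rewrite t0.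
rewrite lerD2l; apply: (@le_trans _ _ (t * (`|c| + 1))).
  by rewrite ler_wpM2l ?(ltW t0)// (le_trans (ler_norm c))// lerDl.
by rewrite -ler_pdivlMr// ge_min lexx orbT.
Qed.

Lemma sqr_dist_continuous (w : 'rV[R]_n) (t : R) :
  continuous (fun q : 'rV[R]_n => t * enorm (q - w) ^+ 2).
Proof.
move=> q; have cq : enorm (q' - w) @[q' --> q] --> enorm (q - w).
  apply: (@cvg_enorm _ _ _ (nbhs q) _ (fun q => q - w)).
  by apply: cvgB; [exact: cvg_id|exact: cvg_cst].
exact: (cvgM (cvg_cst t) (cvgM cq cq)).
Qed.

Lemma prox_exists h w (t : R) : lower_semicontinuous h -> cone_minorized h ->
  effective_domain h !=set0 -> 0 < t -> prox h t w !=set0.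
Proof.
move=> lsch cmh [w0 hw0] t0.
have [c0 [C [C0 hC]]] := cmh.
have [b hb] : exists b, h w0 = b%:E.
  have := cone_minorized_gtNy w0 cmh; move: hw0; rewrite /effective_domain/=.
  by case: (h w0) => // b; exists b.
pose k := (2 * t)^-1.
have k0 : 0 < k by rewrite invr_gt0 mulr_gt0.
pose H := (fun q => h q + (k * enorm (q - w) ^+ 2)%R%:E)%E.
(* [B] gathers the constants in the comparison of [H w0] with the cone bound, which reduces to
   [B <= k * s ^+ 2 - C * s] at distance [s] from [w]. Beyond the radius [M] one has [s > 1] and
   [k * s > C + |B| + 1], which suffices; the last summand of [M] keeps [w0] inside the ball. *)
pose B := b + k * enorm (w0 - w) ^+ 2 - c0 + C * enorm w.
pose M := (C + `|B| + 1) / k + 1 + enorm (w0 - w).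
have [||p _ pmin] := @lsc_attains_min R _ H _ (@compact_enorm_le R n M w).
- exists w0; rewrite /= /M lerDr addr_ge0// divr_ge0 ?(ltW k0)//.
  by rewrite !addr_ge0.
- apply: lsc_add_continuous => //; exact: sqr_dist_continuous.
have w0M : enorm (w0 - w) <= M.
  by rewrite /M lerDr addr_ge0// divr_ge0 ?(ltW k0)// !addr_ge0.
exists p; split=> // q _.
have [qM|Mq] := leP (enorm (q - w)) M; first exact: pmin.
apply: (le_trans (pmin w0 w0M)); rewrite /H hb -EFinD.
apply: (@le_trans _ _ (c0 - C * enorm q + k * enorm (q - w) ^+ 2)%:E); last first.
  by rewrite EFinD leeD2r.
rewrite lee_fin.
set s := enorm (q - w) in Mq *.
have qs : enorm q <= s + enorm w.
  by rewrite -{1}(subrK w q) enormD_le.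
have Cq : C * enorm q <= C * (s + enorm w) by rewrite ler_wpM2l.
have s1 : (C + `|B| + 1) / k + 1 < s.
  by apply: le_lt_trans Mq; rewrite /M lerDl enorm_ge0.
have dv : 0 <= (C + `|B| + 1) / k by rewrite divr_ge0 ?(ltW k0)// !addr_ge0.
have s2 : C + `|B| + 1 < k * s.
  by rewrite mulrC -ltr_pdivrMr//; lra.
have BB := ler_norm B; have B0 := normr_ge0 B.
suff : B <= k * s ^+ 2 - C * s by rewrite /B; lra.
nra.
Qed.

Lemma prox_esubgrad h w p (t : R) : econvex h -> cone_minorized h ->
  effective_domain h !=set0 -> 0 < t -> prox h t w p ->
  esubgrad h (t^-1 *: (w - p)) p.
Proof.
move=> ch cmh [w0 hw0] t0 [_ pmin].
have t20 : 0 < (2 * t)^-1 by rewrite invr_gt0 mulr_gt0.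
have [b hb] : exists b, h p = b%:E.
  have := pmin w0 I; have := cone_minorized_gtNy p cmh; move: hw0.
  rewrite /effective_domain/=.
  by case: (h p) => [b| |]//; [exists b|case: (h w0)].
apply/esubgradP; exists b => // q.
case hqE : (h q) => [e| |]; first last.
- by have := cone_minorized_gtNy q cmh; rewrite hqE.
- by rewrite leey.
rewrite lee_fin; apply: (@le_of_small_slope _ _ ((2 * t)^-1 * dot (q - p) (q - p))).
move=> l l01; have /andP[l0 l1] := l01.
have := pmin (l *: q + (1 - l) *: p) I.
have := @econvex_le h q p e b l ch l01; rewrite hqE hb !lee_fin !lexx.
move=> /(_ isT isT); have := cone_minorized_gtNy (l *: q + (1 - l) *: p) cmh.
case: (h _) => [r| |]// _; rewrite !lee_fin.
rewrite !sqr_enorm.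
have -> : l *: q + (1 - l) *: p - w = l *: (q - p) + (p - w).
  by apply/rowP => i; rewrite !mxE; ring.
rewrite -(opprB p w).
move: (q - p) (p - w) => d1 d2 rle.
rewrite !dot_lin (dotC d1 d2) => H.
rewrite -(ler_pM2l l0) -subr_ge0.
have tE : (2 * t)^-1 = t^-1 / 2 by rewrite invfM mulrC.
move: H; rewrite -subr_ge0 tE; move: (t^-1) => T H; nra.
Qed.

(** Moreau decomposition. The proximal point [p] of [h] at [w] yields a candidate [v] with [p] a
    subgradient of the conjugate at [v]. Adding that subgradient inequality to the minimality of [u]
    leaves only the square of [u - v], which must vanish. *)
Lemma prox_conjugate h w u (t : R) : econvex h -> lower_semicontinuous h ->
  cone_minorized h -> effective_domain h !=set0 -> 0 < t ->
  prox (fenchel_conjugate h) t^-1 (t^-1 *: w) u -> esubgrad h u (w - t *: u).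
Proof.
move=> ch lsch cmh h0 t0 [_ umin].
have [p pP] := prox_exists w lsch cmh h0 t0.
have := prox_esubgrad ch cmh h0 t0 pP.
set v := t^-1 *: (w - p) => vp.
suff -> : u = v.
  have -> // : w - t *: v = p.
  by rewrite /v scalerA mulfV ?gt_eqF// scale1r opprB addrCA subrr addr0.
have [b hb _] := (esubgradP _ _ _).1 vp.
apply/eqP; rewrite -subr_eq0 -dot_eq0 eq_le dot_ge0 andbT.
have := umin v I; rewrite (esubgrad_conjugate vp hb).
have := fenchel_conjugate_ge_affine v u hb.
case: (fenchel_conjugate h u) => [r| |]//.
have tV : t * t^-1 = 1 by rewrite mulfV// gt_eqF.
rewrite -!EFinD !lee_fin !sqr_enorm invfM invrK.
have -> : u - t^-1 *: w = (u - v) - t^-1 *: p.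
  by rewrite /v; apply/rowP => i; rewrite !mxE; ring.
have -> : v - t^-1 *: w = - (t^-1 *: p).
  by rewrite /v; apply/rowP => i; rewrite !mxE; ring.
move: (u - v) => e; rewrite !dot_lin (dotC p e) => H1 H2.
rewrite -(ler_pM2l t0) mulr0.
move: tV H1 H2; move: (t^-1) => T tV H1 H2.
(* Both quadratic expressions are expanded so that the factor [t * T] appears and can be replaced by
   1. *)
have := erefl (2^-1 * t *
  (dot e e - T * dot e p - (T * dot e p - T * (T * dot p p)))).
rewrite [RHS](_ : _ = t * dot e e / 2 - (t * T) * dot e p
  + (t * T) * T * dot p p / 2); last by field.
have := erefl (2^-1 * t * (- - (T * (T * dot p p)))).
rewrite [RHS](_ : _ = (t * T) * T * dot p p / 2); last by field.
rewrite tV !mul1r.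
lra.
Qed.

End ConvexFunctions.

(** * Upper bounds of convex functions near interior points *)

Section LocalBounds.
Context {R : realType} {n : nat}.
Implicit Types (h : 'rV[R]_n -> \bar R) (u v w p q : 'rV[R]_n).

(** [M] bounds [h] at the center and at the finitely many points [w0] plus or minus [e / 2] along
    each axis. Convexity spreads the bound to the axes, then to a small box by averaging the axes
    one at a time. *)
Lemma bounded_above_near_interior h w0 : econvex h -> (forall q, h q != -oo%E) ->
  interior (effective_domain h) w0 ->
  exists d M : R, 0 < d /\ forall q, enorm (q - w0) <= d -> (h q <= M%:E)%E.
Proof.
move=> ch hNy /nbhs_enormP[e e0 eD].
have fin q : enorm (q - w0) < e -> exists b, h q = b%:E.
  by move=> /eD; rewrite /effective_domain/=; have := hNy q; case: (h q) => // b;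
    exists b.
pose dl (i : 'I_n) : 'rV[R]_n := delta_mx 0 i.
have dl1 i : enorm (dl i) = 1.
  rewrite /enorm (_ : dot _ _ = 1) ?sqrtr1//.
  rewrite /dot (bigD1 i)//= big1 => [|j ji]; rewrite !mxE ?eqxx/= ?mulr1 ?addr0//.
  by rewrite (negPf ji) mulr0.
pose pt i (c : R) := w0 + c *: dl i.
pose M := \sum_(i < n) (`|fine (h (pt i (e / 2)))|
  + `|fine (h (pt i (- (e / 2))))|) + `|fine (h w0)|.
have ptfin i c : `|c| < e -> exists b, h (pt i c) = b%:E.
  by move=> ce; apply: fin; rewrite /pt addrC addKr enormZ dl1 mulr1.
have M1 i : (h (pt i (e / 2)%R) <= M%:E)%E /\ (h (pt i (- (e / 2))%R) <= M%:E)%E.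
  have [|b hb] := ptfin i (e / 2); first by rewrite ger0_norm; lra.
  have [|b' hb'] := ptfin i (- (e / 2)); first by rewrite normrN ger0_norm; lra.
  have : `|b| + `|b'| <= M.
    rewrite /M (bigD1 i)//= hb hb'/= -addrA lerDl addr_ge0//.
    by apply: sumr_ge0 => j _; rewrite addr_ge0.
  rewrite hb hb' !lee_fin.
  by have := ler_norm b; have := ler_norm b'; have := normr_ge0 b;
    have := normr_ge0 b'; lra.
have M0 : (h w0 <= M%:E)%E.
  have := fin w0; rewrite subrr enorm0 => /(_ e0)[b hb].
  rewrite hb lee_fin /M hb/=; apply: le_trans (ler_norm b) _.
  by rewrite lerDr sumr_ge0// => i _; rewrite addr_ge0.
have conv p q t : 0 < t < 1 -> (h p <= M%:E)%E -> (h q <= M%:E)%E ->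
    (h (t *: p + (1 - t) *: q)%R <= M%:E)%E.
  move=> t01 pM qM; have := econvex_le ch t01 pM qM.
  by rewrite (_ : t * M + (1 - t) * M = M)//; ring.
have axis i c : `|c| <= e / 2 -> (h (pt i c) <= M%:E)%E.
  move=> ce; have [M1i M2i] := M1 i.
  have [->|c1] := eqVneq c (e / 2); first exact: M1i.
  have [->|c2] := eqVneq c (- (e / 2)); first exact: M2i.
  have {ce} : - (e / 2) < c < e / 2.
    by move: ce; rewrite ler_norml !le_eqVlt [_ == c]eq_sym (negPf c1) (negPf c2).
  move=> /andP[ce1 ce2].
  pose t := (c + e / 2) / e.
  have t01 : 0 < t < 1 by rewrite /t divr_gt0 ?ltr_pdivrMr//; lra.
  have := conv _ _ t t01 M1i M2i.
  have -> // : t *: pt i (e / 2) + (1 - t) *: pt i (- (e / 2)) = pt i c.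
  apply/rowP => j; rewrite !mxE /t; field.
  by rewrite gt_eqF.
(* Each further index writes the point as the midpoint of an axis point and a point with the
   remaining coordinates doubled, hence one factor 2 per index. *)
have box (s : seq 'I_n) (c : 'I_n -> R) :
    (forall i, `|c i| <= e / 2 / 2 ^+ size s) ->
    (h (w0 + \sum_(i <- s) c i *: dl i)%R <= M%:E)%E.
  elim: s c => [|i s IH] c cM; first by rewrite big_nil addr0.
  rewrite big_cons.
  have c2 j : `|2 * c j| <= e / 2 / 2 ^+ size s.
    rewrite normrM ger0_norm//; have := cM j.
    by rewrite /= exprS invfM; lra.
  have h12 : 0 < (1 / 2 : R) < 1 by apply/andP; split; lra.
  have p1 : (h (pt i (2 * c i)%R) <= M%:E)%E.
    apply: axis; apply: (le_trans (c2 i)).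
    rewrite ler_pdivrMr ?exprn_gt0//.
    by rewrite ler_pMr ?divr_gt0// exprn_ege1// ler1n.
  have := conv _ _ _ h12 p1 (IH (fun j => 2 * c j) c2).
  have -> : \sum_(j <- s) (2 * c j) *: dl j = 2 *: \sum_(j <- s) c j *: dl j.
    by rewrite scaler_sumr; apply: eq_bigr => j _; rewrite scalerA.
  move: (\sum_(j <- s) c j *: dl j) => v.
  have -> // : (1 / 2) *: pt i (2 * c i) + (1 - 1 / 2) *: (w0 + 2 *: v)
     = w0 + (c i *: dl i + v).
  by rewrite /pt; apply/rowP => j; rewrite !mxE; field.
exists (e / 2 / 2 ^+ n), M; split; first by rewrite !divr_gt0// exprn_gt0.
move=> q qw; rewrite -(subrK w0 q) addrC (row_sum_delta (q - w0)).
apply: box => i; rewrite -[index_enum _]/(index_enum 'I_n).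
rewrite /index_enum -enumT size_enum_ord; apply: le_trans qw.
exact: enorm_coord.
Qed.

(** A single index [i] serves as the radius [1 / (i + 1)] and as the bound [i], so that [P i] only
    gets easier as [i] grows and compactness yields one index for all of [D]. *)
Lemma compact_bounded_above h (D : set 'rV[R]_n) : econvex h ->
  (forall q, h q != -oo%E) -> compact D -> D `<=` interior (effective_domain h) ->
  exists d M : R, 0 < d /\
    forall c, D c -> forall q, enorm (q - c) <= d -> (h q <= M%:E)%E.
Proof.
move=> ch hNy cD Dint.
pose P (i : nat) c := forall q, enorm (q - c) <= i.+1%:R^-1 -> (h q <= i%:R%:E)%E.
have [|N _ NP] := (compact_near_coveringP D).1 cD nat \oo P _.
  move=> c /Dint /(bounded_above_near_interior ch hNy)[d [M [d0 dM]]].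
  have d20 : 0 < d / 2 by rewrite divr_gt0.
  exists ([set c' | enorm (c' - c) < d / 2],
    [set i | (i.+1%:R^-1 : R) < d / 2 /\ M <= i%:R]) => /=.
    split; first by apply: (iffRL (nbhs_enormP _ _)); exists (d / 2).
    apply: filterI; last exact: nbhs_infty_ger.
    exact: (@cvgr_lt _ _ _ _ _ _ (@cvg_harmonic R)).
  move=> [c' i] /= [c'c [id iM]] q qc'; apply: (@le_trans _ _ M%:E).
    apply: dM; rewrite -(subrK c' q) -addrA; apply: (le_trans (enormD_le _ _)).
    by rewrite (splitr d) lerD// ltW//; exact: le_lt_trans id.
  by rewrite lee_fin.
exists N.+1%:R^-1, N%:R; split; first by rewrite invr_gt0.
by move=> c Dc q; apply: (NP N) => //=.
Qed.

End LocalBounds.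

Lemma convex_setP (R : realType) n (C : set 'rV[R]_n) : convex_set C <->
  forall x y (t : R), C x -> C y -> 0 <= t <= 1 -> C (t *: x + (1 - t) *: y).
Proof.
split=> [cC x y t Cx Cy /andP[t0 t1]|H x y l].
  by have := cC x y (Itv01 t0 t1); rewrite !inE => /(_ Cx Cy).
rewrite !inE => Cx Cy.
by have := H x y l%:num Cx Cy; rewrite ge0 le1 => /(_ isT).
Qed.

(** * Frechet and limiting subgradients against convex ones *)

Section Subdifferentials.
Context {R : realType} {n : nat}.
Implicit Types (h : 'rV[R]_n -> \bar R) (u v w p q : 'rV[R]_n).

Lemma frechet_subdiffI h w v (b : R) : h w = b%:E ->
  (forall e : R, 0 < e -> exists2 d : R, 0 < d &
     forall w', enorm (w' - w) < d ->
       ((b + dot v (w' - w) - e * enorm (w' - w))%R%:E <= h w')%E) ->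
  frechet_subdiff h w v.
Proof.
move=> hw H; split; first by rewrite hw.
rewrite limf_einfE; apply/lee_subgt0Pr => e e0.
have [d d0 dH] := H e e0.
rewrite add0e; apply: (@le_trans _ _ (ereal_inf
  [set ((h w' - h w - (dot v (w' - w)%R)%:E) * (enorm (w' - w))^-1%R%:E)%E |
     w' in [set w' | enorm (w' - w) < d /\ w' != w]])).
  apply: le_ereal_inf_tmp => _ [w' [w'd w'w] <-].
  have s0 : 0 < enorm (w' - w) by rewrite enorm_gt0 subr_eq0.
  have := dH w' w'd; rewrite hw; case: (h w') => [r| |//].
    rewrite -!EFinD -EFinM !lee_fin => K.
    by rewrite ler_pdivlMr//; lra.
  by move=> _; rewrite /= gt0_mulye ?leey// lte_fin invr_gt0.
apply: ereal_sup_ubound; exists [set w' | enorm (w' - w) < d /\ w' != w] => //.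
have : nbhs w [set w' | enorm (w' - w) < d].
  by apply: (iffRL (nbhs_enormP _ _)); exists d.
by rewrite /dnbhs /within/=; apply: filterS.
Qed.

Lemma frechet_limiting h w : frechet_subdiff h w `<=` limiting_subdiff h w.
Proof.
move=> v vw; split; first by case: vw.
by exists (fun=> w), (fun=> v); split=> //; exact: cvg_cst.
Qed.

Lemma esubgrad_frechet h u p : esubgrad h u p -> frechet_subdiff h p u.
Proof.
move=> /esubgradP[b hp H]; apply: (frechet_subdiffI hp) => e e0.
exists 1 => // w' _; apply: le_trans (H w').
by rewrite lee_fin lerBlDr lerDl mulr_ge0 ?enorm_ge0// ltW.
Qed.

(* A second point with the same slope would give a segment of points with
   subgradient [z], on which [h] is affine. *)
Lemma esc_subgrad_strict h z p q (b : R) : econvex h ->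
  essentially_strictly_convex h -> esubgrad h z p -> h p = b%:E -> q != p ->
  ((b + dot z (q - p))%R%:E < h q)%E.
Proof.
move=> ch esch sp hp qp.
have sub q' : ((b + dot z (q' - p))%R%:E <= h q')%E.
  by have [b' hp' H] := (esubgradP _ _ _).1 sp; move: hp'; rewrite hp => -[->].
rewrite lt_neqAle sub andbT; apply/negP => /eqP hq.
pose C := [set p + t *: (q - p) | t in [set t : R | 0 <= t <= 1]].
have onC c : C c -> h c = (b + dot z (c - p))%R%:E.
  move=> [t /andP[t0 t1] <-]; apply/eqP; rewrite eq_le sub andbT.
  rewrite (_ : p + t *: (q - p) - p = t *: (q - p)); last by rewrite addrC addKr.
  have [->|tn0] := eqVneq t 0; first by rewrite scale0r addr0 hp dot0r addr0.
  have [->|tn1] := eqVneq t 1; first by rewrite scale1r (_ : p + (q - p) = q) -?hq// addrC subrK.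
  have t01 : 0 < t < 1 by rewrite !lt_neqAle eq_sym tn0 t0 tn1 t1.
  have hqle : (h q <= (b + dot z (q - p))%R%:E)%E by rewrite hq.
  have hple : (h p <= b%:E)%E by rewrite hp.
  have := econvex_le ch t01 hqle hple.
  rewrite (_ : t *: q + (1 - t) *: p = p + t *: (q - p)); last first.
    by apply/rowP => i; rewrite !mxE; ring.
  by move=> /le_trans; apply; rewrite lee_fin !dot_lin; lra.
have Cp : C p by exists 0; [rewrite /= lexx ler01|rewrite scale0r addr0].
have Cq : C q by exists 1; [rewrite /= ler01 lexx|rewrite scale1r addrC subrK].
have C0 : C !=set0 by exists p.
have convC : convex_set C.
  apply/convex_setP => _ _ a [s /andP[s0 s1] <-] [t /andP[t0 t1] <-] /andP[a0 a1].
  exists (a * s + (1 - a) * t).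
    apply/andP; split; first by rewrite addr_ge0// mulr_ge0// subr_ge0.
    nra.
  by apply/rowP => i; rewrite !mxE; ring.
have subC : C `<=` subdiff_domain h.
  move=> c Cc; exists z; apply: frechet_limiting; apply: esubgrad_frechet.
  apply/esubgradP; exists (b + dot z (c - p)); first exact: onC.
  move=> q'; apply: le_trans (sub q'); rewrite lee_fin !dot_lin; lra.
have h12 : 0 < (1 / 2 : R) < 1 by apply/andP; split; lra.
have := esch C C0 convC subC p q _ Cp Cq _ h12; rewrite eq_sym => /(_ qp).
apply/negP; rewrite -leNgt; apply: le_trans (sub _).
rewrite hp -hq -!EFinM -EFinD lee_fin !dot_lin; lra.
Qed.

End Subdifferentials.

(** * One-sided differentiability of the conjugate and closedness of the subdifferential *)

Section Conjugate.
Context {R : realType} {n : nat}.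
Implicit Types (h : 'rV[R]_n -> \bar R) (u v w p q z : 'rV[R]_n).

Lemma dot_continuous_affine z p (c : R) : continuous (fun q => c * dot z (q - p)).
Proof.
move=> q; have cq : (fun q' => q' - p) @ nbhs q --> q - p.
  by apply: cvgB; [exact: cvg_id|exact: cvg_cst].
exact: (cvgM (cvg_cst c) (cvg_dot (cvg_cst z) cq)).
Qed.

(* [p] is the only maximizer of [<z, .> - h], and by lower semicontinuity and
   convexity the gap grows at least linearly away from [p]; a small
   perturbation of [z] therefore only sees points close to [p]. *)
Lemma conjugate_upper_diff h z p (b e : R) : econvex h ->
  lower_semicontinuous h -> cone_minorized h ->
  essentially_strictly_convex h -> esubgrad h z p -> h p = b%:E -> 0 < e ->
  exists2 d : R, 0 < d & forall v, enorm (v - z) < d ->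
    (fenchel_conjugate h v <= (dot v p - b + e * enorm (v - z))%R%:E)%E.
Proof.
move=> ch lsch cmh esch sp hp e0.
have sub q : ((b + dot z (q - p))%R%:E <= h q)%E.
  by have [b' hp' H] := (esubgradP _ _ _).1 sp; move: hp'; rewrite hp => -[->].
pose H q := (h q + (-1 * dot z (q - p))%R%:E)%E.
have lscH : lower_semicontinuous H.
  by apply: lsc_add_continuous => //; exact: dot_continuous_affine.
pose P (i : nat) q := ((b + i.+1%:R^-1)%R%:E < H q)%E.
have cS : compact [set q | enorm (q - p) = e].
  apply: (@subclosed_compact _ _ [set q | enorm (q - p) <= e]).
  - have -> : [set q | enorm (q - p) = e] =
      (fun q => enorm (q - p)) @^-1` [set t | t = e] by [].
    apply: closed_comp => [u _|]; last exact: closed_eq.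
    apply: (@cvg_enorm _ _ _ (nbhs u) _ (fun u => u - p)).
    by apply: cvgB; [exact: cvg_id|exact: cvg_cst].
  - exact: compact_enorm_le.
  - by move=> q /= ->.
have [|N _ NP] := (compact_near_coveringP _).1 cS nat \oo P _.
  move=> q /= qp.
  have qnp : q != p by rewrite -subr_eq0 -enorm_gt0 qp.
  have bq := esc_subgrad_strict ch esch sp hp qnp.
  have [a ba aq] : exists2 a : R, b < a & (a%:E < H q)%E.
    rewrite /H; move: bq; case: (h q) => [r| |//].
      rewrite lte_fin => br; exists ((b + (r - dot z (q - p))) / 2); first lra.
      by rewrite -EFinD lte_fin; lra.
    by move=> _; exists (b + 1); [lra|rewrite addye// ltry].
  have [V Vq VH] := lscH q a aq.
  exists (V, [set i | (i.+1%:R^-1 : R) < a - b]) => /=.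
    split=> //; apply: (@cvgr_lt _ _ _ _ _ _ (@cvg_harmonic R)).
    by rewrite subr_gt0.
  move=> [q' i] /= [/VH aq' iab]; rewrite /P; apply: le_lt_trans aq'.
  by rewrite lee_fin -lerBrDl ltW.
pose m : R := N.+1%:R^-1.
have m0 : 0 < m by rewrite invr_gt0.
(* Moving [q] towards [p] by the factor [l = e / s] lands on the sphere, where the gap exceeds [m];
   convexity carries this back to [q] with the factor [s / e]. *)
have far q r : h q = r%:E -> e <= enorm (q - p) ->
    m / e * enorm (q - p) <= r - b - dot z (q - p).
  move=> hq; rewrite le_eqVlt => /predU1P[qe|qe].
    have := NP N (leqnn N) q (esym qe); rewrite /P /H hq -EFinD lte_fin -qe.
    by rewrite divfK ?gt_eqF// -/m; lra.
  set s := enorm (q - p) in qe *.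
  have s0 : 0 < s by exact: lt_trans qe.
  pose l := e / s.
  have l01 : 0 < l < 1 by rewrite divr_gt0//= ltr_pdivrMr// mul1r.
  have l0 : 0 < l by case/andP: l01.
  have ls : l * s = e by rewrite /l divfK ?gt_eqF.
  have := @econvex_le R n h q p r b l ch l01; rewrite hq hp !lexx.
  move=> /(_ isT isT).
  have qE : l *: q + (1 - l) *: p - p = l *: (q - p).
    by apply/rowP => i; rewrite !mxE; ring.
  have := NP N (leqnn N) (l *: q + (1 - l) *: p).
  rewrite /= qE enormZ gtr0_norm// -/s ls => /(_ erefl); rewrite /P /H qE.
  case: (h _) => [t| |]//; rewrite -?EFinD ?lee_fin ?lte_fin -/m.
  rewrite !dot_lin; set D := dot z q - dot z p => mt tr.
  have mD : m < l * (r - b - D) by lra.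
  have -> : m / e * s = m / l by rewrite /l; field; rewrite !gt_eqF.
  by rewrite ler_pdivrMr// mulrC ltW.
(* For [enorm (v - z) < m / e] the perturbation [<v - z, q - p>] is absorbed by the gap when [q] is
   at distance at least [e] from [p], and is at most [e * enorm (v - z)], the allowed error,
   otherwise. *)
exists (m / e); first exact: divr_gt0.
move=> v vz; apply: ge_ereal_sup => _ [q _ <-].
case hq : (h q) => [r| |]; first last.
- by have := cone_minorized_gtNy q cmh; rewrite hq.
- by rewrite addeNy leNye.
rewrite -EFinB lee_fin.
have D1 : dot (v - z) (q - p) <= enorm (v - z) * enorm (q - p) by exact: dot_le.
have D2 : dot v q - r = dot v p - b + dot (v - z) (q - p) - (r - b - dot z (q - p)).
  by rewrite !dot_lin; ring.
have [qe|qe] := leP e (enorm (q - p)).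
  have := far q r hq qe; have := enorm_ge0 (v - z); have := enorm_ge0 (q - p).
  nra.
have := sub q; rewrite hq lee_fin; have := enorm_ge0 (v - z); nra.
Qed.

(** Lower semicontinuity bounds the limit of the values from one side only; the subgradient
    inequalities tested at [p0] give the other side. The convergence of values is what later makes
    conjugate values converge. *)
Lemma esubgrad_closed h (u p : nat -> 'rV[R]_n) u0 p0 :
  lower_semicontinuous h -> cone_minorized h -> effective_domain h !=set0 ->
  (forall k, esubgrad h (u k) (p k)) -> u @ \oo --> u0 -> p @ \oo --> p0 ->
  esubgrad h u0 p0 /\ fine (h (p k)) @[k --> \oo] --> fine (h p0).
Proof.
move=> lsch cmh [w0 hw0] upk uu0 pp0.
pose b k := fine (h (p k)).
have hb k : h (p k) = (b k)%:E by rewrite fineK//; case: (upk k).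
have bP k q : ((b k + dot (u k) (q - p k))%R%:E <= h q)%E.
  by have [_ /(_ q)] := upk k; rewrite hb.
have cdot q : dot (u k) (q - p k) @[k --> \oo] --> dot u0 (q - p0).
  exact: (cvg_dot uu0 (cvgB (cvg_cst q) pp0)).
have [b0 hb0] : exists b0, h w0 = b0%:E.
  have := cone_minorized_gtNy w0 cmh; move: hw0; rewrite /effective_domain/=.
  by case: (h w0) => // r; exists r.
(* Testing at a point [w0] of the domain keeps the values bounded above, which rules out
   [h p0 = +oo]. *)
have bup : \forall k \near \oo, b k <= b0 - dot u0 (w0 - p0) + 1.
  near=> k.
  have : b k + dot (u k) (w0 - p k) <= b0 by rewrite -lee_fin -hb0.
  suff : dot u0 (w0 - p0) - 1 < dot (u k) (w0 - p k) by lra.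
  near: k; apply: (cvgr_gt _ (cdot w0)); lra.
have lscP a : (a%:E < h p0)%E -> \forall k \near \oo, a < b k.
  move=> /lsch[V Vp VH]; apply: (@filterS _ \oo _ _ _ _ (pp0 _ Vp)) => k /= /VH.
  by rewrite hb lte_fin.
have [c hc] : exists c, h p0 = c%:E.
  have := cone_minorized_gtNy p0 cmh; case hp0 : (h p0) => [c| |]// _.
    by exists c.
  have := lscP (b0 - dot u0 (w0 - p0) + 1); rewrite hp0 ltry => /(_ isT) blo.
  have [k [k1 k2]] := @filter_ex _ _ _ _ (filterI blo bup).
  by move: (lt_le_trans k1 k2); rewrite ltxx.
have bc : b @ \oo --> c.
  apply/cvgrPdist_le => e e0; near=> k.
  rewrite ler_norml; apply/andP; split.
    have : b k + dot (u k) (p0 - p k) <= c by rewrite -lee_fin -hc.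
    suff : - e < dot (u k) (p0 - p k) by lra.
    near: k; apply: (cvgr_gt _ (cdot p0)).
    by rewrite subrr dot0r oppr_lt0.
  suff : c - e < b k by lra.
  by near: k; apply: lscP; rewrite hc lte_fin; lra.
split; last by rewrite hc.
apply/esubgradP; exists c => // q.
case hq : (h q) => [r| |]; first last.
- by have := cone_minorized_gtNy q cmh; rewrite hq.
- by rewrite leey.
rewrite lee_fin.
have : b k + dot (u k) (q - p k) @[k --> \oo] --> c + dot u0 (q - p0).
  exact: cvgD.
move=> cl; apply: (ler_cvg_to cl (cvg_cst r)); apply: nearW => k.
by rewrite -lee_fin -hq.
Unshelve. all: end_near. Qed.

End Conjugate.

(** * Descent lemma and rates of sequences *)

Section Analysis.
Context {R : realType}.

(** An interior point [w0] makes the affine hull the whole space: any [v] lies on the line through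
    [w0] and a point of the ball around it, and [s] is the dilation factor needed to reach [v]. *)
Lemma relative_interior_sub_interior n (C : set 'rV[R]_n) :
  interior C !=set0 -> relative_interior C `<=` interior C.
Proof.
move=> [w0 /nbhs_enormP[e e0 eC]] w [_ [d d0 dC]].
apply: (iffRL (nbhs_enormP _ _)); exists d => // v vw; apply: dC => //.
pose s := 2 * enorm (v - w0) / e + 1.
have s1 : 1 <= s by rewrite lerDr !mulr_ge0 ?enorm_ge0// invr_ge0 ltW.
have s0 : 0 < s by exact: lt_le_trans s1.
exists 2%N, (fun i => if i == 0 then s else 1 - s),
  (fun i => if i == 0 then w0 + s^-1 *: (v - w0) else w0); split.
- move=> i; case: ifP => _; apply: eC; last by rewrite subrr enorm0.
  rewrite addrC addKr enormZ ger0_norm ?invr_ge0 ?ltW//.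
  rewrite mulrC ltr_pdivrMr// /s mulrDr mulr1 mulrC divfK ?gt_eqF//.
  by have := enorm_ge0 (v - w0); lra.
- by rewrite big_ord_recl big_ord1/=; ring.
- rewrite big_ord_recl big_ord1/=.
  by apply/rowP => i; rewrite !mxE; field; rewrite gt_eqF.
Qed.

Lemma dot_gradE n (phi : 'rV[R]_n -> R) x v :
  differentiable phi x -> dot (grad phi x) v = 'd phi x v.
Proof.
move=> dphi; rewrite {2}(row_sum_delta v) linear_sum/=.
by apply: eq_bigr => i _; rewrite linearZ/= mxE mulrC.
Qed.

Lemma is_derive_along n (phi : 'rV[R]_n -> R) (x d : 'rV[R]_n) (t : R) :
  differentiable phi (x + t *: d) ->
  is_derive t 1 (fun t => phi (x + t *: d)) (dot (grad phi (x + t *: d)) d).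
Proof.
move=> dphi.
have H : (fun h : R => h^-1 *: (phi (x + (h *: 1 + t) *: d) - phi (x + t *: d)))
   = (fun h : R => h^-1 *: (phi (h *: d + (x + t *: d)) - phi (x + t *: d))).
  apply/funext => h; congr (_ *: (phi _ - _)).
  by rewrite scalerDl addrCA /GRing.scale/= mulr1.
have D : derivable phi (x + t *: d) d by exact: diff_derivable.
split; first by rewrite /derivable/= H; exact: D.
by rewrite /derive/= H dot_gradE// -deriveE.
Qed.

Lemma is_derive_sub_quadratic (f : R -> R) (s a b t Df : R) :
  is_derive t (1 : R) f Df ->
  is_derive t (1 : R) (fun t => s * f t - a * t - b * t ^+ 2)
    (s * Df - a - 2 * b * t).
Proof.
move=> D.
have -> : (fun t => s * f t - a * t - b * t ^+ 2) =
  s *: f - a *: (@id R) - b *: ((@id R) ^+ 2) by [].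
apply: is_derive_eq.
rewrite /GRing.scale/=.
ring.
Qed.

(** No integration: after subtracting the linear and quadratic terms along the segment, the
    derivative is nonpositive and the mean value theorem concludes. The sign [s] treats both
    inequalities at once. *)
Lemma descent_lemma n (phi : 'rV[R]_n -> R) (L : R) (x y : 'rV[R]_n) :
  (forall u, differentiable phi u) ->
  (forall u v, enorm (grad phi u - grad phi v) <= L * enorm (u - v)) ->
  `|phi y - phi x - dot (grad phi x) (y - x)| <= L / 2 * enorm (y - x) ^+ 2.
Proof.
move=> dphi Lphi.
suff H (s : R) : `|s| = 1 ->
    s * (phi y - phi x - dot (grad phi x) (y - x)) <= L / 2 * enorm (y - x) ^+ 2.
  rewrite ler_norml; apply/andP; split.
    by rewrite lerNl -mulN1r H// normrN1.
  by rewrite -[leLHS]mul1r H// normr1.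
move=> s1; set d := y - x.
pose psi (t : R) := s * phi (x + t *: d) - s * dot (grad phi x) d * t
  - L / 2 * enorm d ^+ 2 * t ^+ 2.
pose dpsi (t : R) := s * dot (grad phi (x + t *: d)) d - s * dot (grad phi x) d
  - 2 * (L / 2 * enorm d ^+ 2) * t.
have psiD (t : R) : is_derive t (1 : R) psi (dpsi t).
  have D := is_derive_along (dphi (x + t *: d)).
  by apply: is_derive_sub_quadratic.
have [|c c01] := @MVT R psi dpsi 0 1 ltr01 (fun t _ => psiD t).
  apply: derivable_within_continuous => t _.
  by have [] := psiD t.
rewrite in_itv/= in c01; have /andP[c0 c1] := c01.
rewrite subr0 mulr1 /psi scale1r scale0r addr0 expr1n expr0n/= !mulr1 !mulr0 !subr0.
have -> : x + d = y by rewrite addrC subrK.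
move=> E; suff : dpsi c <= 0 by rewrite -E mulrBr mulrBr; lra.
have : x + c *: d - x = c *: d by rewrite addrC addKr.
rewrite /dpsi; move: (x + c *: d) => p pE.
have : s * dot (grad phi p - grad phi x) d <= L * enorm d ^+ 2 * c.
  apply: (le_trans (ler_norm _)); rewrite normrM s1 mul1r.
  apply: (le_trans (norm_dot_le _ _)).
  apply: (@le_trans _ _ (L * enorm (p - x) * enorm d)).
    by rewrite ler_wpM2r ?enorm_ge0.
  by rewrite pE enormZ gtr0_norm//; lra.
by move: (grad phi) => G; rewrite dotDl dotNl; lra.
Qed.

Lemma derive1_scaled_powR (sigma theta t : R) : theta < 1 -> 0 < t ->
  derive1 (fun t => sigma / (1 - theta) * t `^ (1 - theta)) t
  = sigma * t `^ (- theta).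
Proof.
move=> th1 t0; rewrite derive1E.
have D := is_derive1_powR (1 - theta) t0.
have -> : (fun t => sigma / (1 - theta) * t `^ (1 - theta)) =
  (sigma / (1 - theta)) *: (fun t => t `^ (1 - theta)) by [].
rewrite deriveZ; last by case: D.
rewrite derive_val /GRing.scale/= mulrA divfK ?subr_eq0 ?gt_eqF//.
by congr (_ * _ `^ _); ring.
Qed.

(** After factoring out [x], this is [(1 + 1/x)^(-b) >= 1 - b * ln (1 + 1/x) >= 1 - b / x]. *)
Lemma powR_decrement (b x : R) : 0 < b -> 0 < x ->
  x `^ (- b) - (x + 1) `^ (- b) <= b * (x `^ (- b) / x).
Proof.
move=> b0 x0.
have -> : x + 1 = x * (1 + x^-1) by rewrite mulrDr mulr1 mulfV ?gt_eqF.
have x1 : 0 < x^-1 by rewrite invr_gt0.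
rewrite powRM ?(ltW x0) ?addr_ge0 ?(ltW x1)//.
have : 1 - b / x <= (1 + x^-1) `^ (- b).
  rewrite /powR gt_eqF ?addr_gt0//.
  apply: le_trans (expR_ge1Dx _); rewrite lerD2l mulNr lerN2 ler_wpM2l ?(ltW b0)//.
  by apply: le_ln1Dx; lra.
move: ((1 + x^-1) `^ (- b)) => Z bZ.
have := powR_gt0 (- b) x0; move: (x `^ _) => X X0.
rewrite (_ : b * (X / x) = X * (b / x)); last by ring.
rewrite (_ : X - X * Z = X * (1 - Z)); last by ring.

by rewrite ler_wpM2l ?(ltW X0)//; lra.
Qed.

(** * Decay rates from a recursion implicit in the next term *)

Section Rates.
Context (e : nat -> R) (C theta : R) (N : nat).
Context (C_gt0 : 0 < C) (e_ge0 : forall k, (N <= k)%N -> 0 <= e k)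
  (e_cvg : e @ \oo --> (0 : R))
  (e_rec : forall k, (N <= k)%N -> 0 < e k.+1 ->
     (e k.+1 `^ theta) ^+ 2 <= C * (e k - e k.+1)).

(** With exponent 0 the left side of the recursion is 1, so a positive [e k.+1] forces a drop of at
    least [1 / C], impossible once [e k < C^-1]. *)
Lemma finite_rate : theta = 0 -> \forall k \near \oo, e k = 0.
Proof.
move=> th0.
have c2 : \forall k \near \oo, e k < C^-1.
  by apply: (cvgr_lt _ e_cvg); rewrite invr_gt0.
have [M _ HM] := c2.
exists (maxn N M).+1 => // k /=; case: k => // k; rewrite ltnS geq_max => /andP[Nk Mk].
apply/eqP; apply: contraPT (HM k Mk) => ek.
have ek0 : 0 < e k.+1 by rewrite lt_def ek e_ge0// leqW.
have := e_rec Nk ek0; rewrite th0 powRr0 expr1n => H /= H2.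
have : C * e k < 1 by rewrite mulrC -ltr_pdivlMr// div1r.
by have := mulr_gt0 C_gt0 ek0; rewrite mulrBr in H; lra.
Qed.

(** Once [e] is below 1, [2 * theta <= 1] gives [e k.+1 <= (e k.+1)^(2 theta)], hence
    [(1 + C) * e k.+1 <= C * e k]. *)
Lemma linear_rate : 0 < theta <= 1 / 2 -> forall n0, exists (k0 : nat) (q kap : R),
  [/\ (n0 <= k0)%N, 0 < q < 1, 0 < kap &
      forall k, (k0 <= k)%N -> 0 <= e k <= kap * q ^+ k].
Proof.
move=> /andP[th0 th1] n0.
have c2 : \forall k \near \oo, e k < 1 by apply: (cvgr_lt _ e_cvg).
have [M _ HM] := c2.
pose k0 := (maxn n0 (maxn N M)).
have [n0k [Nk Mk]] : (n0 <= k0)%N /\ (N <= k0)%N /\ (M <= k0)%N.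
  by rewrite /k0 !leq_max !leqnn !orbT.
pose q := C / (1 + C).
have C1 : 0 < 1 + C by rewrite addr_gt0.
have q0 : 0 < q by rewrite divr_gt0.
(* The summand 1 keeps the constant positive even when [e k0 = 0]. *)
exists k0, q, (e k0 / q ^+ k0 + 1); split=> //.
- by rewrite q0/= ltr_pdivrMr// mul1r ltrDr.
- by rewrite ltr_wpDl// divr_ge0 ?e_ge0// exprn_ge0// ltW.
move=> k k0k; rewrite e_ge0 ?(leq_trans Nk)//=.
suff : e k <= e k0 / q ^+ k0 * q ^+ k.
  by move=> /le_trans; apply; rewrite ler_wpM2r ?exprn_ge0 ?ltW// ltrDl.
elim: k k0k => [|k IH].
  by rewrite leqn0 => /eqP ->; rewrite expr0 divr1 mulr1.
rewrite leq_eqVlt => /predU1P[->|]; first by rewrite divfK// expf_neq0// gt_eqF.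
rewrite ltnS => k0k; have {}IH := IH k0k.
have Nk' := leq_trans Nk k0k.
have := e_ge0 (leqW Nk'); rewrite le_eqVlt => /predU1P[<-|ek].
  by rewrite !mulr_ge0 ?invr_ge0 ?exprn_ge0 ?e_ge0// ltW.
have := e_rec Nk' ek.
have : e k.+1 <= (e k.+1 `^ theta) ^+ 2.
  rewrite -powR_mulrn ?powR_ge0// -powRrM -{1}(powRr1 (ltW ek)).
  apply: ger_powR; last lra.
  by rewrite ek/=; apply: ltW; apply: HM => /=; rewrite (leq_trans Mk)// leqW.
move=> h1 h2.
have h3 : e k.+1 <= q * e k.
  by rewrite /q mulrAC ler_pdivlMr//; lra.
by apply: (le_trans h3); rewrite exprS mulrCA ler_wpM2l// (ltW q0).
Qed.

(** Direct induction on the bound [kap * k^(-b)]: a term above it would require a larger decrease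
    than [powR_decrement] allows between consecutive bounds. *)
Lemma sublinear_rate : 1 / 2 < theta < 1 -> forall n0, exists (k0 : nat) (kap : R),
  [/\ (n0 <= k0)%N, 0 < kap &
      forall k, (k0 <= k)%N -> 0 <= e k <= kap * k%:R `^ (- (2 * theta - 1)^-1)].
Proof.
move=> /andP[th0 th1] n0.
pose nu := 2 * theta - 1; pose b := nu^-1.
have nu0 : 0 < nu by rewrite /nu; lra.
have b0 : 0 < b by rewrite invr_gt0.
(* The factor [2 ^ b] pays for replacing [k^(-b)] by [(k + 1)^(-b)], the last 2 for replacing
   [1 / k] by [2 / (k + 1)]. *)
pose D := C * b * 2 `^ b * 2.
have D0 : 0 < D by rewrite !mulr_gt0 ?powR_gt0.
pose k0 := maxn 1 (maxn n0 N).
have [k01 [n0k Nk]] : (1 <= k0)%N /\ (n0 <= k0)%N /\ (N <= k0)%N.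
  by rewrite /k0 !leq_max !leqnn !orbT.
(* The first summand starts the induction at [k0]; the second ensures [D <= kap ^ nu]. *)
pose kap := e k0 * k0%:R `^ b + D `^ b.
have kap0 : 0 < kap by rewrite ltr_wpDl ?powR_gt0// mulr_ge0 ?e_ge0 ?powR_ge0.
have kapD : D <= kap `^ nu.
  rewrite -[leLHS](powRr1 (ltW D0)) -(mulVf (lt0r_neq0 nu0)) powRrM -/b.
  apply: ge0_ler_powR; rewrite ?nnegrE ?powR_ge0 ?(ltW nu0) ?(ltW kap0)//.
  by rewrite lerDr mulr_ge0 ?e_ge0 ?powR_ge0.
exists k0, kap; split=> //; rewrite -/nu -/b.
move=> k k0k; rewrite e_ge0 ?(leq_trans Nk)//=.
elim: k k0k => [|k IH].
  by rewrite leqn0 => /eqP E; rewrite E in k01.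
rewrite leq_eqVlt => /predU1P[<-|].
  rewrite powRN ler_pdivlMr ?powR_gt0 ?ltr0n//.
  by rewrite lerDl powR_ge0.
rewrite ltnS => k0k; have {}IH := IH k0k.
have k1 : (1 <= k)%N := leq_trans k01 k0k.
have K0 : (0 : R) < k%:R by rewrite ltr0n.
(* Since [2 * theta = 1 + nu] and [b * nu = 1], the power [y^(2 theta)] equals
   [y * kap^nu / (k + 1)]. The recursion would put it strictly below [y * D / (k + 1)], against
   [kapD]. *)
rewrite leNgt; apply/negP; set y := kap * _ => ye.
have y0 : 0 < y by rewrite mulr_gt0// powR_gt0// ltr0n.
have := e_rec (leq_trans Nk k0k) (lt_trans y0 ye).
set X := k%:R `^ (- b) in IH *; set Y := k.+1%:R `^ (- b) in y y0 ye *.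
have X0 : 0 < X by rewrite powR_gt0.
have Y0 : 0 < Y by rewrite powR_gt0 ?ltr0n.
have k10 : (0 : R) < k.+1%:R by rewrite ltr0n.
have k1E : (k.+1%:R : R) = k%:R + 1 by rewrite -addn1 natrD.
have dec : X - Y <= b * (X / k%:R) by rewrite /X /Y k1E powR_decrement.
have XY : X <= 2 `^ b * Y.
  rewrite /X /Y !powRN ler_pdivlMr ?powR_gt0// mulrC ler_pdivrMr ?powR_gt0//.
  rewrite -powRM// ?(ltW K0)//; apply: ge0_ler_powR;
    rewrite ?nnegrE ?(ltW b0) ?(ltW k10) ?mulr_ge0 ?(ltW K0)//.
  have : (1 : R) <= k%:R by rewrite ler1n.
  by rewrite k1E; lra.
have kk : k%:R^-1 <= 2 / (k.+1%:R : R).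
  rewrite ler_pdivlMr// mulrC ler_pdivrMr//.
  have : (1 : R) <= k%:R by rewrite ler1n.
  by rewrite k1E; lra.
have ynu : y * (kap `^ nu / k.+1%:R) <= (e k.+1 `^ theta) ^+ 2.
  have -> : y * (kap `^ nu / k.+1%:R) = (y `^ theta) ^+ 2.
    have -> : (y `^ theta) ^+ 2 = y `^ (1 + nu).
      by rewrite -powR_mulrn ?powR_ge0// -powRrM /nu; congr (_ `^ _); ring.
    rewrite [RHS]powRD; last by apply/implyP => _; exact: lt0r_neq0.
    rewrite powRr1 ?(ltW y0)//; congr (_ * _).
    rewrite /y powRM ?(ltW kap0) ?(ltW Y0)// /Y -powRrM mulNr /b mulVf ?gt_eqF//.
    by rewrite powR_inv1// ltW.
  have yl : y `^ theta <= e k.+1 `^ theta.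
    by apply: ge0_ler_powR; rewrite ?nnegrE ?(ltW y0) ?(ltW ye) ?(ltW (lt_trans y0 ye))//; lra.
  by rewrite ler_pXn2r ?nnegrE ?powR_ge0.
move=> H.
have H1 : y * (kap `^ nu / k.+1%:R) < C * kap * (b * (X / k%:R)).
  apply: (le_lt_trans ynu); apply: (le_lt_trans H).
  apply: (@lt_le_trans _ _ (C * (kap * X - y))).
    by rewrite ltr_pM2l//; lra.
  by rewrite /y -mulrBr mulrA ler_wpM2l// mulr_ge0// ltW.
have H2 : X / k%:R <= (2 `^ b * Y) * (2 / k.+1%:R).
  by apply: ler_pM => //; rewrite ?invr_ge0 ltW.
have H3 : C * kap * (b * (X / k%:R)) <= y * (D / k.+1%:R).
  apply: (@le_trans _ _ (C * kap * (b * ((2 `^ b * Y) * (2 / k.+1%:R))))).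
    by rewrite !ler_wpM2l ?mulr_ge0// ltW.
  by rewrite le_eqVlt; apply/orP; left; apply/eqP; rewrite /y /D; ring.
have := lt_le_trans H1 H3.
by rewrite ltr_pM2l// ltr_pM2r ?invr_gt0// ltNge kapD.
Qed.

End Rates.
End Analysis.

(** * Inequalities for one primal or dual step *)

Section Steps.
Context {R : realType}.

Lemma metric_proj_vi n (S : set 'rV[R]_n) w x : convex_set S ->
  metric_proj S w x -> forall u, S u -> dot (w - x) (u - x) <= 0.
Proof.
move=> /convex_setP cS [Sx xmin] u Su.
suff : 0 <= dot (x - w) (u - x) by rewrite -opprB dotNl; lra.
rewrite -(@ler_pM2l _ 2)// mulr0.
apply: (@le_of_small_slope _ _ _ (dot (u - x) (u - x))) => t /andP[t0 t1].
have t01 : 0 <= t <= 1 by rewrite !ltW.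
have := xmin _ (cS u x t Su Sx t01); rewrite lee_fin.
have -> : t *: u + (1 - t) *: x - w = (x - w) + t *: (u - x).
  by apply/rowP => i; rewrite !mxE; ring.
move: (x - w) (u - x) => d1 d2.
rewrite -(@ler_pXn2r _ 2)// ?nnegrE ?enorm_ge0// !sqr_enorm !dot_lin (dotC d2 d1).
by move=> H; rewrite -(ler_pM2l t0) mulr0; nra.
Qed.

(** The subgradient inequality makes the mean slope of [h] from [w - t *: u] to [w] at least
    [enorm u]. By convexity the slope near [w] is no smaller, and only there is the Lipschitz bound
    available. *)
Lemma esubgrad_lipschitz_bound n (h : 'rV[R]_n -> \bar R) u w (t l d : R) :
  econvex h -> 0 <= l -> 0 < t -> 0 < d -> h w \is a fin_num ->
  (forall q, enorm (q - w) <= d -> (`|h w - h q| <= (l * enorm (w - q))%:E)%E) ->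
  esubgrad h u (w - t *: u) -> enorm u <= l.
Proof.
move=> ch l0 t0 d0 /fineK; set c := fine _ => hw lip /esubgradP[b hb H].
have [->|u0] := eqVneq u 0; first by rewrite enorm0.
have eu : 0 < enorm u by rewrite enorm_gt0.
have H1 := H w; rewrite -hw lee_fin opprB addrCA subrr addr0 in H1.
rewrite dotZr -sqr_enorm in H1.
(* [s] is small enough for the point at distance [s * t * enorm u] from [w] to stay in the ball of
   radius [d]. *)
pose s := Num.min (1 / 2) (d / (t * enorm u)).
have s0 : 0 < s by rewrite lt_min !divr_gt0// mulr_gt0.
have s1 : s < 1 by rewrite gt_min; apply/orP; left; lra.
have s01 : 0 < s < 1 by rewrite s0.
have hble : (h (w - t *: u)%R <= b%:E)%E by rewrite hb.
have hwle : (h w <= c%:E)%E by rewrite -hw.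
have := econvex_le ch s01 hble hwle.
have -> : s *: (w - t *: u) + (1 - s) *: w = w - (s * t) *: u.
  by apply/rowP => i; rewrite !mxE; ring.
have st : 0 < s * t by rewrite mulr_gt0.
have := lip (w - (s * t) *: u).
rewrite opprB addrCA subrr addr0 addrC addKr enormN enormZ gtr0_norm//.
have -> : s * t * enorm u <= d.
  rewrite -mulrA -ler_pdivlMr ?mulr_gt0//.
  by rewrite ge_min lexx orbT.
move=> /(_ isT); rewrite -hw; case: (h _) => [e| |]//.
rewrite -EFinB abse_EFin !lee_fin => H2 H3.
have H4 : c - e <= l * (s * t * enorm u) by apply: le_trans H2; exact: ler_norm.
have H5 : s * (c - b) <= s * (l * (t * enorm u)) by lra.
rewrite ler_pM2l// in H5.
have te : 0 < t * enorm u by rewrite mulr_gt0.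
by rewrite -(ler_pM2r te); lra.
Qed.

(* The monotonicity of the subdifferential of [g^*], in the form [mono], enters
   with the multiplier [4 alpha / tau]. *)
Lemma dual_step_quadratic n (alpha tau gamma : R) (a d e : 'rV[R]_n) :
  0 < alpha -> 0 < tau -> tau <= gamma -> 2 * alpha <= gamma ->
  0 <= dot (a + alpha *: d - (alpha + tau) *: e) e ->
  dot e a + alpha * dot e d - tau / 2 * dot e e
    + alpha / 2 * (1 + 4 * alpha / tau) * (dot e e - dot d d)
  <= 3 * gamma / (2 * tau ^+ 2) * dot a a - tau / 8 * dot e e.
Proof.
move=> a0 t0 tg ag mono.
have g0 : 0 < gamma by exact: lt_le_trans tg.
pose m := 4 * alpha / tau.
have mt : m * tau = 4 * alpha by rewrite /m divfK// gt_eqF.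
have m0 : 0 < m by rewrite !divr_gt0// mulr_gt0.
pose U := 3 * gamma / (2 * tau ^+ 2).
have U0 : 0 < U by rewrite divr_gt0 ?mulr_gt0// exprn_gt0.
have Ut : U * tau ^+ 2 = 3 * gamma / 2.
  by rewrite /U; field; rewrite gt_eqF.
rewrite -/m -/U.
have mono2 : m * (alpha + tau) * dot e e <= m * (dot e a + alpha * dot e d).
  rewrite -mulrA ler_pM2l//; move: mono.
  by rewrite !dot_lin (dotC a e) (dotC d e); lra.
have Q : 2 * dot e d <= dot e e + dot d d.
  by have := dot_ge0 (e - d); rewrite !dot_lin (dotC d e); lra.
have Y := dot_ge0 ((2 * U) *: a - (1 + m) *: e).
rewrite !dot_lin (dotC a e) in Y.
have E0 := dot_ge0 e.
(* Adding [mono2] and splitting [<e, d>] cancels the square of [d], which is the purpose of the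
   weight [alpha / 2 * (1 + m)], and leaves [-(3 alpha + tau / 2)] in front of the square of [e].
   Reserving [tau / 8], this is the discriminant condition for the rest to absorb
   [(1 + m) <e, a>]. *)
have mU : (1 + m) ^+ 2 <= 4 * U * (3 * alpha + 3 * tau / 8).
  have t2 : 0 < tau ^+ 2 by rewrite exprn_gt0.
  rewrite -(ler_pM2r t2).
  have -> : (1 + m) ^+ 2 * tau ^+ 2 = (tau + 4 * alpha) ^+ 2.
    by rewrite -mt; ring.
  have -> : 4 * U * (3 * alpha + 3 * tau / 8) * tau ^+ 2 =
    6 * gamma * (3 * alpha + 3 * tau / 8).
    by rewrite mulrAC -(mulrA 4) Ut; field.
  have h1 : alpha * tau <= alpha * gamma by rewrite ler_pM2l.
  have h2 : alpha * (2 * alpha) <= alpha * gamma by rewrite ler_pM2l.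
  have h3 : tau * tau <= tau * gamma by rewrite ler_pM2l.
  have h4 : 0 < alpha * tau by rewrite mulr_gt0.
  by nra.
have P : (1 + m) * dot e a <= U * dot a a + (3 * alpha + 3 * tau / 8) * dot e e.
  have U4 : 0 < 4 * U by rewrite mulr_gt0.
  rewrite -(ler_pM2l U4).
  have := ler_wpM2r E0 mU.
  by move: Y; nra.
have c0 : 0 < alpha * (1 + m) / 2 by rewrite divr_gt0// mulr_gt0// addr_gt0.
have Q2 := ler_wpM2l (ltW c0) Q.
have mtE : m * tau * dot e e = 4 * alpha * dot e e by rewrite mt.
move: P mono2 Q2 mtE; move: (dot e a) (dot e d) (dot e e) (dot d d) (dot a a).
move=> ea ed ee dd aa; clear; nra.
Qed.

End Steps.

(** * The merit function and its Frechet subgradients *)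

Section MeritFunction.
Context {R : realType} {n p s : nat}.
Context (S : set 'rV[R]_n) (f : 'rV[R]_p -> \bar R) (g : 'rV[R]_s -> \bar R)
  (phi : 'rV[R]_n -> R) (A : 'M[R]_(n, s)) (K : 'M[R]_(n, p))
  (alpha alphat : R).

Let c := alpha / 2 * (1 + 4 * alpha / (alphat - alpha)).
Let vp := varpi S f g phi A K alpha alphat.

(* [varpi] where it is finite: [gs] and [fs] stand for the values of [g^*] at
   [z] and of [f^*] at [y]. *)
Definition rvarpi (x : 'rV[R]_n) (y : 'rV[R]_p) (z u : 'rV[R]_s) (gs fs : R) :=
  dot z (x *m A) - gs + phi x - dot (x *m K) y + fs
  + alpha / 2 * (1 + 4 * alpha / (alphat - alpha)) * enorm (z - u) ^+ 2
  - 1 / 2 * (alphat - alpha) * enorm z ^+ 2.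

Lemma varpi_fin x y z u gs fs : S x ->
  fenchel_conjugate g z = gs%:E -> fenchel_conjugate f y = fs%:E ->
  varpi S f g phi A K alpha alphat x y z u = (rvarpi x y z u gs fs)%:E.
Proof.
move=> Sx gz fy; rewrite /varpi gz fy /indicator_function mem_set// adde0.
by rewrite -!(EFinD, EFinN).
Qed.

Lemma varpi_pinfty x y z u gs : (~ S x \/ fenchel_conjugate f y = +oo%E) ->
  fenchel_conjugate g z = gs%:E -> fenchel_conjugate f y != -oo%E ->
  varpi S f g phi A K alpha alphat x y z u = +oo%E.
Proof.
move=> h gz fNy; rewrite /varpi gz /indicator_function.
case: ifPn => xS.
  have -> : fenchel_conjugate f y = +oo%E.
    by case: h => // nS; move: xS; rewrite inE.
  by [].
by case: (fenchel_conjugate f y) fNy.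
Qed.

Lemma enorm_row_mx_le m1 m2 (u : 'rV[R]_m1) (v : 'rV[R]_m2) :
  [/\ enorm u <= enorm (row_mx u v), enorm v <= enorm (row_mx u v) &
    enorm (row_mx u v) <= enorm u + enorm v].
Proof.
have := sqr_enorm (row_mx u v); rewrite dot_row_mx -!sqr_enorm.
have := enorm_ge0 u; have := enorm_ge0 v; have := enorm_ge0 (row_mx u v).
move: (enorm (row_mx u v)) (enorm u) (enorm v) => a b d a0 d0 b0 H.
by split; rewrite -(@ler_pXn2r _ 2)// ?nnegrE ?addr_ge0// H;
  have := mulr_ge0 d0 b0; nra.
Qed.

Definition row4 (x : 'rV[R]_n) (y : 'rV[R]_p) (z u : 'rV[R]_s) :=
  row_mx x (row_mx y (row_mx z u)).

Lemma uncurry4_row4 (h : 'rV[R]_n -> 'rV[R]_p -> 'rV[R]_s -> 'rV[R]_s -> \bar R)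
  x y z u : uncurry4 h (row4 x y z u) = h x y z u.
Proof. by rewrite /uncurry4 /row4 !(row_mxKl, row_mxKr). Qed.

Lemma row4P w : exists x y z u, w = row4 x y z u.
Proof.
exists (lsubmx w), (lsubmx (rsubmx w)), (lsubmx (rsubmx (rsubmx w))),
  (rsubmx (rsubmx (rsubmx w))).
by rewrite /row4 !hsubmxK.
Qed.

Lemma row4B x y z u x' y' z' u' :
  row4 x y z u - row4 x' y' z' u' = row4 (x - x') (y - y') (z - z') (u - u').
Proof. by rewrite /row4 !opp_row_mx !add_row_mx. Qed.

Lemma dot_row4 x y z u x' y' z' u' :
  dot (row4 x y z u) (row4 x' y' z' u') =
  dot x x' + dot y y' + dot z z' + dot u u'.
Proof. by rewrite /row4 !dot_row_mx !addrA. Qed.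

Lemma enorm_row4 x y z u :
  [/\ enorm x <= enorm (row4 x y z u), enorm y <= enorm (row4 x y z u),
      enorm z <= enorm (row4 x y z u), enorm u <= enorm (row4 x y z u) &
      enorm (row4 x y z u) <= enorm x + enorm y + enorm z + enorm u].
Proof.
rewrite /row4.
have [h1 h2 h3] := enorm_row_mx_le x (row_mx y (row_mx z u)).
have [h4 h5 h6] := enorm_row_mx_le y (row_mx z u).
have [h7 h8 h9] := enorm_row_mx_le z u.
by split; lra.
Qed.

(** An exact expansion in the increments, used twice: its linear part is the Frechet subgradient,
    and for the increments of one iteration it is the starting point of the descent estimate. *)
Lemma rvarpi_sub x y z u dx dy dz du gs fs gs' fs' :
  rvarpi (x + dx) (y + dy) (z + dz) (u + du) gs' fs' - rvarpi x y z u gs fs =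
  dot (z *m A^T) dx + dot (x *m A) dz + dot dz (dx *m A) - (gs' - gs)
  + (phi (x + dx) - phi x)
  - (dot (y *m K^T) dx + dot (x *m K) dy + dot (dx *m K) dy) + (fs' - fs)
  + c * (2 * (dot (z - u) dz - dot (z - u) du) + enorm (dz - du) ^+ 2)
  - 1 / 2 * (alphat - alpha) * (2 * dot z dz + enorm dz ^+ 2).
Proof.
rewrite /rvarpi -/c !sqr_enorm.
have -> : z + dz - (u + du) = (z - u) + (dz - du) by rewrite opprD addrACA.
rewrite (dotC (z *m A^T) dx) (dotC (y *m K^T) dx) -!dot_mulmx !mulmxDl.
rewrite ![dot (z - u + _) _]dotDl ![dot (z - u) (z - u + _)]dotDr.
rewrite ![dot (dz - du) (z - u + _)]dotDr.
rewrite (dotC (dz - du) (z - u)) ![dot (z - u) (dz - du)]dotDr.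
rewrite [dot (z - u) (- du)]dotNr.
rewrite !(dotDl, dotDr) (dotC dz z) (dotC dz (x *m A)) (dotC z (dx *m A)).
ring.
Qed.

(** The normal vector [nx] and the convex [f^*] give linear lower bounds, [-g^*] gives one up to a
    first-order small error by [conjugate_upper_diff], and all other remainders are quadratic or
    nonnegative. Where [S] or the domain of [f^*] is left, [varpi] is [+oo]. *)
Lemma varpi_frechet (L : R) x y z u nx q pz :
  0 <= L -> 0 < alpha -> alpha < alphat ->
  (forall u, differentiable phi u) ->
  (forall u v, enorm (grad phi u - grad phi v) <= L * enorm (u - v)) ->
  econvex g -> lower_semicontinuous g -> cone_minorized g ->
  essentially_strictly_convex g -> S x ->
  (forall x', S x' -> dot nx (x' - x) <= 0) ->
  esubgrad f y q -> esubgrad g z pz ->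
  frechet_subdiff (uncurry4 vp) (row4 x y z u)
    (row4 (grad phi x + z *m A^T - y *m K^T + nx) (q - x *m K)
      (x *m A - pz + (2 * c) *: (z - u) - (alphat - alpha) *: z)
      ((2 * c) *: (u - z))).
Proof.
move=> L0 a0 at0 dphi Lphi cg lscg cmg escg Sx nxP fq gp.
have [bf hbf Hf] := (esubgradP _ _ _).1 fq.
have [bg hbg Hg] := (esubgradP _ _ _).1 gp.
have fy := esubgrad_conjugate fq hbf; have gz := esubgrad_conjugate gp hbg.
apply: (@frechet_subdiffI _ _ _ _ _ (rvarpi x y z u (dot z pz - bg) (dot y q - bf))).
  by rewrite uncurry4_row4 /vp (varpi_fin _ Sx gz fy).
move=> e e0.
have e20 : 0 < e / 2 by rewrite divr_gt0.
have [d d0 Hd] := conjugate_upper_diff cg lscg cmg escg gp hbg e20.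
have t0 : 0 < alphat - alpha by rewrite subr_gt0.
have c0 : 0 <= c by rewrite mulr_ge0 ?divr_ge0 ?addr_ge0// ?divr_ge0 ?mulr_ge0// ltW.
have [cA cA0 HA] := mulmx_bounded A; have [cK cK0 HK] := mulmx_bounded K.
(* One summand for each quadratic remainder that may be negative: two bilinear couplings, the
   descent lemma, and the concave square in [z]. *)
pose M := cA + cK + L / 2 + 1 / 2 * (alphat - alpha).
have M0 : 0 <= M by rewrite !addr_ge0// ?divr_ge0// mulr_ge0// ltW.
(* Half of [e] goes to the error of [g^*], the other half to the quadratic remainders. *)
pose d2 := Num.min d (e / 2 / (M + 1)).
have M1 : 0 < M + 1 by rewrite ltr_wpDl.
exists d2; first by rewrite lt_min d0 divr_gt0.
move=> w'; have [x' [y' [z' [u' ->]]]] := row4P w'.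
rewrite row4B lt_min => /andP[wd we].
have [nx' ny nz nu _] := enorm_row4 (x' - x) (y' - y) (z' - z) (u' - u).
have := enorm_ge0 (row4 (x' - x) (y' - y) (z' - z) (u' - u)).
rewrite dot_row4.
move: (enorm (row4 _ _ _ _)) wd we nx' ny nz nu => s0 wd we nx' ny nz nu s00.
have Hgz' := Hd z' (le_lt_trans nz wd).
have gz'ge := fenchel_conjugate_ge g z' pz; rewrite hbg in gz'ge.
have fy'ge := fenchel_conjugate_ge f y' q; rewrite hbf in fy'ge.
have [gs' gs'E] : exists gs', fenchel_conjugate g z' = gs'%:E.
  by move: Hgz' gz'ge; case: (fenchel_conjugate g z') => // r; exists r.
rewrite gs'E lee_fin in Hgz'.
rewrite uncurry4_row4 /vp.
have fNy : fenchel_conjugate f y' != -oo%E.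
  by move: fy'ge; case: (fenchel_conjugate f y').
have [Sx'|nSx'] := pselect (S x'); last first.
  by rewrite (varpi_pinfty _ _ gs'E)//; [rewrite leey|left].
case fs'E : (fenchel_conjugate f y') fNy => [fs'| |]// _; last first.
  by rewrite (varpi_pinfty _ _ gs'E)//; [rewrite leey|right|rewrite fs'E].
rewrite (varpi_fin _ Sx' gs'E fs'E) lee_fin.
rewrite fs'E lee_fin in fy'ge.
have desc := descent_lemma x x' dphi Lphi.
move: desc; rewrite ler_norml => /andP[desc _].
have nxx := nxP _ Sx'.
have zz : dot z' pz = dot z pz + dot pz (z' - z) by rewrite !dot_lin !(dotC pz); ring.
have yy : dot y' q = dot y q + dot q (y' - y) by rewrite !dot_lin !(dotC q); ring.
have := rvarpi_sub x y z u (x' - x) (y' - y) (z' - z) (u' - u)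
  (dot z pz - bg) (dot y q - bf) gs' fs'.
have addKB m (a b : 'rV[R]_m) : a + (b - a) = b by rewrite addrC subrK.
rewrite !addKB {addKB} zz in Hgz' *; rewrite yy in fy'ge.
move: (rvarpi x' y' z' u' gs' fs') desc nxx nx' ny nz nu Hgz' fy'ge.
move: (rvarpi x y z u _ _) (phi x') (phi x).
move: (x' - x) (y' - y) (z' - z) (u' - u) {Hd Hf Hg nxP} => dx dy dz du.
move=> r0 phi' phi0 r1 desc nxx hx hy hz hu Hgz' fy'ge diff.
have b1 : - (cA * s0 ^+ 2) <= dot dz (dx *m A).
  have := norm_dot_le dz (dx *m A); rewrite ler_norml => /andP[+ _].
  apply: le_trans; rewrite lerN2.
  apply: (@le_trans _ _ (s0 * (cA * s0))); last by rewrite expr2 mulrCA.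
  apply: ler_pM; rewrite ?enorm_ge0//.
  by apply: (le_trans (HA _)); rewrite ler_wpM2l.
have b2 : dot (dx *m K) dy <= cK * s0 ^+ 2.
  apply: (le_trans (dot_le _ _)).
  apply: (@le_trans _ _ ((cK * s0) * s0)); last by rewrite expr2 mulrA.
  apply: ler_pM; rewrite ?enorm_ge0//.
  by apply: (le_trans (HK _)); rewrite ler_wpM2l.
have sq (t : R) : 0 <= t -> t <= s0 -> t ^+ 2 <= s0 ^+ 2.
  by move=> t1 t2; rewrite ler_pXn2r.
have b3 := ler_wpM2l (divr_ge0 L0 (ler0n R 2)) (sq _ (enorm_ge0 dx) hx).
have tau2 : 0 <= 1 / 2 * (alphat - alpha) by rewrite mulr_ge0// ltW.
have b4 := ler_wpM2l tau2 (sq _ (enorm_ge0 dz) hz).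
have b5 : 0 <= c * enorm (dz - du) ^+ 2 by rewrite mulr_ge0// sqr_ge0.
have b6 : M * s0 ^+ 2 <= e / 2 * s0.
  rewrite expr2 mulrA ler_wpM2r//.
  move: we; rewrite ltr_pdivlMr// => we; lra.
have b7 : e / 2 * enorm dz <= e / 2 * s0 by rewrite ler_wpM2l// ltW.
rewrite [M * _]mulrDl ![(_ + _) * s0 ^+ 2]mulrDl in b6.
rewrite mulrDr mulrBr in diff.
rewrite !(dotDl, dotZl, dotNl).
rewrite !(dotDl, dotNl) in diff.
lra.
Qed.

End MeritFunction.

(** * Decrease of the merit function in one iteration *)

Section MeritDescent.
Context {R : realType} {n p s : nat}.
Context (phi : 'rV[R]_n -> R) (A : 'M[R]_(n, s)) (K : 'M[R]_(n, p))
  (alpha alphat : R).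

Lemma merit_descent x1 y1 z1 z0 dx dy dz gs fs gs' fs' (rho bet gam mu L : R) :
  0 < alpha -> alpha < alphat -> alphat - alpha <= gam -> 2 * alpha <= gam ->
  rho * dot dx dx <= - dot (grad phi x1 + z1 *m A^T - y1 *m K^T) dx ->
  phi (x1 + dx) <= phi x1 + dot (grad phi x1) dx + L / 2 * dot dx dx ->
  fs' + bet * dot dy dy <= fs + dot ((x1 + dx) *m K) dy ->
  gs + dot (x1 *m A + alpha *: z0 - alphat *: z1) dz <= gs' ->
  gs' - dot ((x1 + dx) *m A + alpha *: z1 - alphat *: (z1 + dz)) dz <= gs ->
  L / 2 + 3 * opnorm A ^+ 2 * gam / (2 * (alphat - alpha) ^+ 2) + mu <= rho ->
  rvarpi phi A K alpha alphat (x1 + dx) (y1 + dy) (z1 + dz) z1 gs' fs'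
  <= rvarpi phi A K alpha alphat x1 y1 z1 z0 gs fs - mu * dot dx dx
     - bet * dot dy dy - (alphat - alpha) / 8 * dot dz dz.
Proof.
move=> a0 at0 tg ag Ha Hb Hc Hd Hm Hr.
have t0 : 0 < alphat - alpha by rewrite subr_gt0.
have g0 : 0 < gam by exact: lt_le_trans tg.
have := rvarpi_sub phi A K alpha alphat x1 y1 z1 z0 dx dy dz (z1 - z0) gs fs gs' fs'.
have -> : z0 + (z1 - z0) = z1 by rewrite addrC subrK.
have z0E : z0 = z1 - (z1 - z0) by rewrite opprB addrCA subrr addr0.
rewrite z0E in Hd; move: Hd.
move: (rvarpi _ _ _ _ _ _ _ _ z1 _ _) => r1.
move: (rvarpi _ _ _ _ _ _ _ _ z0 _ _) => r0.
move: (z1 - z0) => d Hd {z0E} diff.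
have mono : 0 <= dot (dx *m A + alpha *: d - (alpha + (alphat - alpha)) *: dz) dz.
  move: Hd Hm; rewrite mulmxDl scalerBr scalerDr.
  move: (x1 *m A) (dx *m A) => X Y.
  by rewrite !(dotDl, dotNl, dotZl); lra.
have := dual_step_quadratic a0 t0 tg ag mono.
set c := alpha / 2 * _ in diff *.
have Hs : dot (dx *m A) (dx *m A) <= opnorm A ^+ 2 * dot dx dx.
  rewrite -!sqr_enorm -exprMn ler_pXn2r ?nnegrE ?enorm_ge0//.
    exact: enorm_mulmx_le.
  by apply: le_trans (enorm_mulmx_le _ _); exact: enorm_ge0.
have U0 : 0 <= 3 * gam / (2 * (alphat - alpha) ^+ 2).
  by rewrite divr_ge0 ?mulr_ge0 ?exprn_ge0// ltW.
have := ler_wpM2l U0 Hs.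
have := ler_wpM2r (dot_ge0 dx) Hr.
rewrite (_ : 3 * opnorm A ^+ 2 * gam / (2 * (alphat - alpha) ^+ 2) =
  3 * gam / (2 * (alphat - alpha) ^+ 2) * opnorm A ^+ 2); last by ring.
move: (3 * gam / (2 * (alphat - alpha) ^+ 2)) {U0 mono Hs Hr} => U Hr Hs Hq.
rewrite !sqr_enorm in diff.
move: diff Hd {Hm} Ha Hc; rewrite !mulmxDl.
rewrite ?(dotC (x1 *m A) dz).
rewrite !(dotDl, dotNl, dotZl, dotDr, dotNr, dotZr).
rewrite ?(dotC (dx *m A) dz) ?(dotC d dz) ?(dotC (x1 *m A) dz) ?(dotC dz z1).
move: (phi (x1 + dx)) Hb => *.
lra.
Qed.

End MeritDescent.

(** * The adaptive algorithm *)

Section Algorithm.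
Context {R : realType} {n p s : nat}.
Context (S : set 'rV[R]_n) (f : 'rV[R]_p -> \bar R) (g : 'rV[R]_s -> \bar R)
  (A : 'M[R]_(n, s)) (K : 'M[R]_(n, p)) (phi : 'rV[R]_n -> R) (lphi : R)
  (r lg : R) (gamma alpha mu eps : R)
  (betalo betahi : R) (beta : nat -> R) (a : nat -> R)
  (idx : nat -> nat) (alphas : nat -> R)
  (x : nat -> 'rV[R]_n) (y : nat -> 'rV[R]_p) (z : nat -> 'rV[R]_s).
Context (S_nonempty : S !=set0) (S_convex : convex_set S) (S_compact : compact S)
  (f_proper : proper_function f) (f_convex : econvex f)
  (f_lsc : lower_semicontinuous f)
  (g_proper : proper_function g) (g_convex : econvex g)
  (g_lsc : lower_semicontinuous g)
  (phi_diff : forall u, differentiable phi u)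
  (lphi_gt0 : 0 < lphi)
  (phi_lip : forall u v, enorm (grad phi u - grad phi v) <= lphi * enorm (u - v))
  (KS_ri : [set u *m K | u in S] `<=` relative_interior (effective_domain f))
  (r_gt0 : 0 < r)
  (Kr_int : [set w | (edistance w [set u *m A | u in S] <= r%:E)%E]
            `<=` interior (effective_domain g))
  (lg_gt0 : 0 < lg)
  (g_lip : forall w w',
     (edistance w [set u *m A | u in S] <= r%:E)%E ->
     (edistance w' [set u *m A | u in S] <= r%:E)%E ->
     (`|g w - g w'| <= (lg * enorm (w - w'))%:E)%E)
  (g_esc : essentially_strictly_convex g)
  (f_int : interior (effective_domain f) !=set0)
  (gamma_bounds : 0 < gamma <= 2 * r / lg)
  (alpha_bounds : 0 < alpha < gamma / 2)
  (mu_gt0 : 0 < mu)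
  (eps_gt0 : 0 < eps)
  (betalo_gt0 : 0 < betalo)
  (beta_bounds : forall k, betalo <= beta k <= betahi)
  (a_ref : reference_sequence alpha gamma a)
  (z0_bound : enorm (z 0%N) <= lg)
  (dpfs : adaptive_dpfs S f g phi A K lphi alpha gamma mu eps beta a
            idx alphas x y z).

Let alpha_gt0 : 0 < alpha. Proof. by case/andP: alpha_bounds. Qed.

Let gamma_gt0 : 0 < gamma. Proof. by case/andP: gamma_bounds. Qed.

Lemma edistance_image_le u w : S u -> enorm (w - u *m A) <= r ->
  (edistance w [set u *m A | u in S] <= r%:E)%E.
Proof.
move=> Su wu; apply: (@le_trans _ _ (enorm (w - u *m A))%:E).
  by apply: ereal_inf_lbound; exists (u *m A) => //; exists u.
by rewrite lee_fin.
Qed.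

Lemma f_cone_minorized : cone_minorized f.
Proof.
have [w0 w0P] := f_int.
have [d [M [d0 dM]]] := bounded_above_near_interior f_convex f_proper.1 w0P.
exact: (bounded_above_cone_minorized f_convex f_proper.1 d0 dM).
Qed.

Lemma g_cone_minorized : cone_minorized g.
Proof.
have [u Su] := S_nonempty.
have uP : interior (effective_domain g) (u *m A).
  by apply: Kr_int; apply: (edistance_image_le Su); rewrite subrr enorm0 ltW.
have [d [M [d0 dM]]] := bounded_above_near_interior g_convex g_proper.1 uP.
exact: (bounded_above_cone_minorized g_convex g_proper.1 d0 dM).
Qed.

Lemma x_in_S k : S (x k.+1).
Proof. by have [? ? xP _ _ _] := dpfs; case: (xP k). Qed.

Lemma beta_gt0 k : 0 < beta k.
Proof. by apply: lt_le_trans betalo_gt0 _; case/andP: (beta_bounds k). Qed.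

Lemma a_gt j : alpha < a j.
Proof.
case: j => [|j]; last by have /andP[] := ref_bounds a_ref j.
by rewrite (ref_init a_ref) ltrDl.
Qed.

Lemma a_le j : a j <= alpha + gamma.
Proof.
elim: j => [|j IH]; first by rewrite (ref_init a_ref).
by have /andP[_ h] := ref_bounds a_ref j; exact: le_trans IH.
Qed.

Lemma alphas_gt k : alpha < alphas k.
Proof. by rewrite (dpfs_alphas dpfs) a_gt. Qed.

Lemma y_esubgrad k :
  esubgrad f (y k.+1) (x k.+1 *m K + beta k *: (y k - y k.+1)).
Proof.
have b0 := beta_gt0 k.
have := @prox_conjugate _ _ f (beta k *: y k + x k.+1 *m K) (y k.+1) (beta k)
  f_convex f_lsc f_cone_minorized f_proper.2 b0.
rewrite scalerDr scalerA mulVf ?gt_eqF// scale1r => /(_ (dpfs_y dpfs k)).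
by rewrite scalerBr [beta k *: y k + _]addrC addrA.
Qed.

Lemma z_esubgrad k :
  esubgrad g (z k.+1) (x k.+1 *m A + alpha *: z k - alphas k *: z k.+1).
Proof.
have a0 : 0 < alphas k := lt_trans alpha_gt0 (alphas_gt k).
have := @prox_conjugate _ _ g (alpha *: z k + x k.+1 *m A) (z k.+1) (alphas k)
  g_convex g_lsc g_cone_minorized g_proper.2 a0.
rewrite scalerDr scalerA mulrC => /(_ (dpfs_z dpfs k)).
by rewrite [alpha *: z k + _]addrC.
Qed.

(** The slack [r - alpha * lg] becomes the radius of a ball on which [g] is Lipschitz. *)
Lemma alpha_lg_lt_r : alpha * lg < r.
Proof.
have /andP[_ h1] := alpha_bounds; have /andP[_ h2] := gamma_bounds.
have : alpha < r / lg by apply: (lt_le_trans h1); lra.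
by rewrite ltr_pdivlMr.
Qed.

(* [z k.+1] is the gradient of a Moreau envelope of [g] at a point of the
   [r]-neighborhood of [A(S)], where [g] is [lg]-Lipschitz. *)
Lemma z_bound k : enorm (z k) <= lg.
Proof.
elim: k => // k IH.
have a0 : 0 < alphas k := lt_trans alpha_gt0 (alphas_gt k).
set w := x k.+1 *m A + alpha *: z k.
have wx : enorm (w - x k.+1 *m A) <= alpha * lg.
  by rewrite /w addrC addKr enormZ gtr0_norm// ler_pM2l.
have d0 : 0 < r - alpha * lg by rewrite subr_gt0 alpha_lg_lt_r.
have wq q : enorm (q - w) <= r - alpha * lg ->
    (edistance q [set u *m A | u in S] <= r%:E)%E.
  move=> qw; apply: (edistance_image_le (x_in_S k)).
  by rewrite -(subrK w q) -addrA; apply: (le_trans (enormD_le _ _)); lra.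
have ww : (edistance w [set u *m A | u in S] <= r%:E)%E.
  by apply: wq; rewrite subrr enorm0 ltW.
apply: (@esubgrad_lipschitz_bound _ _ g _ w _ _ _ g_convex (ltW lg_gt0) a0 d0).
- have := nbhs_singleton (Kr_int ww); rewrite /effective_domain/=.
  by have := g_proper.1 w; case: (g w).
- by move=> q /wq; exact: g_lip.
- exact: z_esubgrad.
Qed.

(** As [z] is bounded by [lg], the test cannot succeed at an index [J] with
    [(a J - alpha) * lg <= eps]; the index is thus monotone and bounded, so eventually constant, and
    from then on the test fails. *)
Lemma eventually_stabilized :
  exists (K0 : nat) (alphat : R), stabilized alpha eps alphas z K0 alphat.
Proof.
have [J _ JP] : \forall j \near \oo, (a j - alpha) * lg <= eps.
  have : (a j - alpha) * lg @[j --> \oo] --> (alpha - alpha) * lg.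
    exact: (cvgM (cvgB (ref_lim a_ref) (cvg_cst alpha)) (cvg_cst lg)).
  by rewrite subrr mul0r => h; apply: (cvgr_le _ h).
have idxJ k : (idx k <= J)%N.
  elim: k => [|k IH]; first by rewrite (dpfs_idx0 dpfs).
  rewrite (dpfs_idxS dpfs); case: ifPn => // lt.
  rewrite ltn_neqAle IH andbT; apply/eqP => iJ.
  have := JP _ (leqnn J); rewrite -{1}iJ -(dpfs_alphas dpfs) => le.
  have ak : 0 <= alphas k - alpha by rewrite subr_ge0 ltW// alphas_gt.
  have := le_trans (ler_wpM2l ak (z_bound k.+1)) le.
  by rewrite leNgt lt.
have idx_le k : (idx k <= idx k.+1)%N.
  by rewrite (dpfs_idxS dpfs); case: ifPn.
have idx_mono k k' : (k <= k')%N -> (idx k <= idx k')%N.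
  elim: k' => [|k' IH]; first by rewrite leqn0 => /eqP ->.
  rewrite leq_eqVlt => /predU1P[->//|/IH/leq_trans]; exact.
(* Induction on the room left below [J]: either the index is constant from [k] on, or it increases
   and less room remains. *)
have const m k : (J - idx k <= m)%N ->
    exists K0, forall k', (K0 <= k')%N -> idx k' = idx K0.
  elim: m k => [|m IH] k km.
    exists k => k' kk'; apply/eqP; rewrite eqn_leq (idx_mono _ _ kk') andbT.
    by apply: (leq_trans (idxJ k')); rewrite -subn_eq0 -leqn0.
  have [H|/existsNP[k' /not_implyP[kk' ne]]] :=
      pselect (forall k', (k <= k')%N -> idx k' = idx k).
    by exists k.
  apply: (IH k'); have := idx_mono _ _ kk'; rewrite leq_eqVlt => /predU1P[E|lt].
    by rewrite E in ne.
  have := idxJ k'; move: km lt; clear; lia.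
have [K0 K0P] := const _ 0%N (leqnn _).
exists K0, (alphas K0); split; first exact: alphas_gt.
move=> k K0k; split; first by rewrite !(dpfs_alphas dpfs) K0P.
rewrite leNgt; apply/negP => lt; have := dpfs_idxS dpfs k.
by rewrite lt (K0P k)// (K0P k.+1) ?leqW// => /eqP; rewrite -[_ == _]/(_ == _) ltn_eqF.
Qed.

(** * Descent, bounds and subgradients after stabilization *)

Section Stabilized.
Context (K0 : nat) (alphat : R).
Context (stab : stabilized alpha eps alphas z K0 alphat).

Let c := alpha / 2 * (1 + 4 * alpha / (alphat - alpha)).
Let vp := varpi S f g phi A K alpha alphat.

Let alphat_gt : alpha < alphat. Proof. by case: stab. Qed.

Let tau_gt0 : 0 < alphat - alpha. Proof. by rewrite subr_gt0. Qed.

Let alphasE k : (K0 <= k)%N -> alphas k = alphat.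
Proof. by case: stab => _ /[apply] -[]. Qed.

Let tau_le_gamma : alphat - alpha <= gamma.
Proof.
by rewrite lerBlDl; have := a_le (idx K0); rewrite -(dpfs_alphas dpfs) alphasE.
Qed.

Let rho := lphi / 2 + 3 * opnorm A ^+ 2 * gamma / (2 * (alphat - alpha) ^+ 2) + mu.

Let rho_gt0 : 0 < rho.
Proof.
have h1 : 0 <= 3 * opnorm A ^+ 2 * gamma.
  by apply: mulr_ge0 (ltW gamma_gt0); apply: mulr_ge0; rewrite ?sqr_ge0.
have h2 : 0 <= 2 * (alphat - alpha) ^+ 2 by apply: mulr_ge0; rewrite ?sqr_ge0.
apply: (ltr_wpDl _ mu_gt0); apply: addr_ge0 (divr_ge0 h1 h2).
by apply: divr_ge0 => //; exact: ltW.
Qed.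

(** [ydual k] and [zdual k] are the primal points at which [y k.+1] and [z k.+1] are subgradients of
    [f] and [g]; for [zdual] this holds from [K0] on, where the current parameter is [alphat]. *)
Definition ydual k := x k.+1 *m K + beta k *: (y k - y k.+1).
Definition zdual k := x k.+1 *m A + alpha *: z k - alphat *: z k.+1.
Definition fstar k := dot (y k.+1) (ydual k) - fine (f (ydual k)).
Definition gstar k := dot (z k.+1) (zdual k) - fine (g (zdual k)).

(* The value of [varpi] at the iterate of index [k.+1]. *)
Definition merit k := rvarpi phi A K alpha alphat
  (x k.+1) (y k.+1) (z k.+1) (z k) (gstar k) (fstar k).

Lemma fstarE k : fenchel_conjugate f (y k.+1) = (fstar k)%:E.
Proof.
have H := y_esubgrad k; apply: (esubgrad_conjugate H).
by rewrite fineK//; case: H.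
Qed.

Lemma zdual_esubgrad k : (K0 <= k)%N -> esubgrad g (z k.+1) (zdual k).
Proof. by move=> kK; have := z_esubgrad k; rewrite alphasE. Qed.

Lemma gstarE k : (K0 <= k)%N -> fenchel_conjugate g (z k.+1) = (gstar k)%:E.
Proof.
move=> kK; have H := zdual_esubgrad kK; apply: (esubgrad_conjugate H).
by rewrite fineK//; case: H.
Qed.

Lemma meritE k : (K0 <= k)%N ->
  vp (x k.+1) (y k.+1) (z k.+1) (z k) = (merit k)%:E.
Proof. by move=> kK; apply: varpi_fin; [exact: x_in_S|exact: gstarE|exact: fstarE]. Qed.

(** The projection step, scaled by [rho], exhibits an outward normal to [S] at [x k.+1]; it serves
    both the descent and the subgradient estimate. *)
Lemma x_vi k u : (K0 <= k)%N -> S u ->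
  dot (rho *: (x k - x k.+1) - (grad phi (x k) + z k *m A^T - y k *m K^T))
    (u - x k.+1) <= 0.
Proof.
move=> kK Su; have := dpfs_x dpfs k; rewrite alphasE// -/rho.
move=> /(metric_proj_vi S_convex)/(_ _ Su).
have -> : x k + rho^-1 *: (- grad phi (x k) + y k *m K^T - z k *m A^T) - x k.+1 =
  rho^-1 *: (rho *: (x k - x k.+1) - (grad phi (x k) + z k *m A^T - y k *m K^T)).
  rewrite [RHS]scalerBr scalerA mulVf ?gt_eqF// scale1r.
  by apply/rowP => i; rewrite !mxE; ring.
by rewrite dotZl pmulr_rle0// invr_gt0.
Qed.

Definition step k := enorm (x k.+1 - x k) ^+ 2 + enorm (y k.+1 - y k) ^+ 2
  + enorm (z k.+1 - z k) ^+ 2.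

Lemma step_ge0 k : 0 <= step k.
Proof. by rewrite !addr_ge0 ?sqr_ge0. Qed.

Let kappa := Num.min mu (Num.min betalo ((alphat - alpha) / 8)).

Let kappa_gt0 : 0 < kappa.
Proof. by rewrite !lt_min mu_gt0 betalo_gt0 divr_gt0. Qed.

(** [merit k] sits at the iterate [k.+1], so the decrease is measured by the move from [k.+1] to
    [k.+2], which is [step k.+1]. *)
Lemma merit_step k : (K0 <= k)%N -> merit k.+1 <= merit k - kappa * step k.+1.
Proof.
move=> kK; have kK1 := leqW kK.
have := @merit_descent R n p s phi A K alpha alphat (x k.+1) (y k.+1) (z k.+1)
  (z k) (x k.+2 - x k.+1) (y k.+2 - y k.+1) (z k.+2 - z k.+1) (gstar k) (fstar k)
  (gstar k.+1) (fstar k.+1) rho (beta k.+1) gamma mu lphi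
  alpha_gt0 alphat_gt tau_le_gamma.
have addKB m (u v : 'rV[R]_m) : u + (v - u) = v by rewrite addrC subrK.
rewrite !addKB -!sqr_enorm => H.
apply: (@le_trans _ _ (merit k - mu * enorm (x k.+2 - x k.+1) ^+ 2
  - beta k.+1 * enorm (y k.+2 - y k.+1) ^+ 2
  - (alphat - alpha) / 8 * enorm (z k.+2 - z k.+1) ^+ 2)); last first.
  have k1 : kappa <= mu by rewrite ge_min lexx.
  have k2 : kappa <= beta k.+1.
    have /andP[b1 _] := beta_bounds k.+1.
    by apply: le_trans b1; rewrite !ge_min lexx !orbT.
  have k3 : kappa <= (alphat - alpha) / 8 by rewrite !ge_min lexx !orbT.
  have := ler_wpM2r (sqr_ge0 (enorm (x k.+2 - x k.+1))) k1.
  have := ler_wpM2r (sqr_ge0 (enorm (y k.+2 - y k.+1))) k2.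
  have := ler_wpM2r (sqr_ge0 (enorm (z k.+2 - z k.+1))) k3.
  by rewrite /step; lra.
apply: H.
- by have /andP[_ h] := alpha_bounds; lra.
- have := x_vi kK1 (x_in_S k); rewrite sqr_enorm.
  rewrite -(opprB (x k.+2) (x k.+1)) dotNr.
  move: (x k.+2 - x k.+1) (grad phi (x k.+1) + _ - _) => d v.
  by rewrite dotDl scalerN !dotNl dotZl; lra.
- have := descent_lemma (x k.+1) (x k.+2) phi_diff phi_lip.
  by rewrite ler_norml => /andP[_]; lra.
- have H : esubgrad f (y k.+2) (ydual k.+1) := y_esubgrad k.+1.
  have hE : f (ydual k.+1) = (fine (f (ydual k.+1)))%:E by rewrite fineK//; case: H.
  have := fenchel_conjugate_ge_affine (y k.+2) (y k.+1) hE.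
  rewrite fstarE lee_fin -/(fstar k.+1) -(opprB (y k.+2) (y k.+1)) dotNr.
  rewrite /ydual dotDl dotZl -(opprB (y k.+2) (y k.+1)) dotNl sqr_enorm.
  lra.
- have H := zdual_esubgrad kK.
  have hE : g (zdual k) = (fine (g (zdual k)))%:E by rewrite fineK//; case: H.
  have := fenchel_conjugate_ge_affine (z k.+1) (z k.+2) hE.
  by rewrite gstarE// lee_fin.
- have H := zdual_esubgrad kK1.
  have hE : g (zdual k.+1) = (fine (g (zdual k.+1)))%:E by rewrite fineK//; case: H.
  have := fenchel_conjugate_ge_affine (z k.+2) (z k.+1) hE.
  by rewrite gstarE// lee_fin -(opprB (z k.+2)) dotNr.
- by rewrite /rho.
Qed.

(** [f] is at most [M] on a [d]-neighborhood of [K(S)]; testing [f^*] at [K x] moved by [d] in the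
    direction of [y] gives [f^*(y) - <K x, y> >= d * enorm y - M]. All other terms are bounded below
    because [x] and [z] are bounded. This bounds both [merit] and [y]. *)
Lemma merit_ge : exists B d : R, 0 < d /\
  forall k, (K0 <= k)%N -> B + d * enorm (y k.+1) <= merit k.
Proof.
have [X [X0 XP]] := compact_enorm_bounded S_compact.
have [u0 Su0] := S_nonempty.
have [cA cA0 HA] := mulmx_bounded A.
have [c0 [C [C0 gC]]] := g_cone_minorized.
have KSc : compact [set u *m K | u in S].
  apply: continuous_compact S_compact; apply: continuous_subspaceT => u.
  exact: (@cvg_mulmx _ _ _ K _ (nbhs u) _ id u).
have KSi : [set u *m K | u in S] `<=` interior (effective_domain f).
  by move=> w /KS_ri; exact: relative_interior_sub_interior.
have [d [M [d0 dM]]] := compact_bounded_above f_convex f_proper.1 KSc KSi.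
pose P := cA * X + alpha * lg + alphat * lg.
pose G := enorm (grad phi u0).
exists (- (lg * (cA * X)) - (lg * P - (c0 - C * P))
  + (phi u0 - G * (2 * X) - lphi / 2 * (2 * X) ^+ 2) - M
  - 1 / 2 * (alphat - alpha) * lg ^+ 2), d.
split=> // k kK.
have Sx := x_in_S k; have xX := XP _ Sx.
have zl := z_bound k.+1.
have xA : enorm (x k.+1 *m A) <= cA * X.
  by apply: le_trans (HA _) _; rewrite ler_wpM2l.
have alphat_gt0 : 0 < alphat := lt_trans alpha_gt0 alphat_gt.
have pP : enorm (zdual k) <= P.
  apply: le_trans (enormB_le _ _) _; rewrite enormZ (gtr0_norm alphat_gt0).
  apply: lerD; last by rewrite ler_pM2l.
  apply: le_trans (enormD_le _ _) _; rewrite enormZ (gtr0_norm alpha_gt0).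
  by apply: lerD => //; rewrite ler_pM2l// z_bound.
have h1 : - (lg * (cA * X)) <= dot (z k.+1) (x k.+1 *m A).
  have := norm_dot_le (z k.+1) (x k.+1 *m A); rewrite ler_norml => /andP[+ _].
  apply: le_trans; rewrite lerN2; apply: ler_pM; rewrite ?enorm_ge0//.
have h2 : gstar k <= lg * P - (c0 - C * P).
  have H := zdual_esubgrad kK.
  have hE : g (zdual k) = (fine (g (zdual k)))%:E by rewrite fineK//; case: H.
  have := gC (zdual k); rewrite hE lee_fin => gl.
  have d1 : dot (z k.+1) (zdual k) <= lg * P.
    apply: le_trans (dot_le _ _) _.
    by apply: ler_pM; rewrite ?enorm_ge0.
  have d2 : C * enorm (zdual k) <= C * P by rewrite ler_wpM2l.
  by rewrite /gstar; lra.
have xu : enorm (x k.+1 - u0) <= 2 * X.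
  by apply: le_trans (enormB_le _ _) _; have := XP _ Su0; lra.
have h3 : phi u0 - G * (2 * X) - lphi / 2 * (2 * X) ^+ 2 <= phi (x k.+1).
  have := descent_lemma u0 (x k.+1) phi_diff phi_lip.
  rewrite ler_norml => /andP[+ _].
  have : - (G * (2 * X)) <= dot (grad phi u0) (x k.+1 - u0).
    have := norm_dot_le (grad phi u0) (x k.+1 - u0); rewrite ler_norml => /andP[+ _].
    by apply: le_trans; rewrite lerN2 ler_wpM2l ?enorm_ge0.
  have : lphi / 2 * enorm (x k.+1 - u0) ^+ 2 <= lphi / 2 * (2 * X) ^+ 2.
    rewrite ler_pM2l ?divr_gt0// ler_pXn2r ?nnegrE ?enorm_ge0//.
    by rewrite mulr_ge0.
  lra.
have h4 : d * enorm (y k.+1) - M <= fstar k - dot (x k.+1 *m K) (y k.+1).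
  (* For [y k.+1 = 0] this is the zero vector, and both claims still hold. *)
  pose v := (d / enorm (y k.+1)) *: y k.+1.
  have [vd dv] : enorm v <= d /\ dot (y k.+1) v = d * enorm (y k.+1).
    have [y0|y0] := eqVneq (y k.+1) 0.
      by rewrite /v y0 scaler0 dot0l enorm0 mulr0 ltW.
    have ey : enorm (y k.+1) != 0 by rewrite enorm_eq0.
    rewrite /v enormZ ger0_norm ?divr_ge0 ?enorm_ge0 ?(ltW d0)//.
    rewrite divfK//; split=> //.
    by rewrite dotZr -sqr_enorm expr2 mulrA divfK.
  have := fenchel_conjugate_ge f (y k.+1) (x k.+1 *m K + v).
  have KSx : [set u *m K | u in S] (x k.+1 *m K) by exists (x k.+1).
  have := dM _ KSx (x k.+1 *m K + v).
  rewrite (_ : x k.+1 *m K + v - x k.+1 *m K = v); last by rewrite addrC addKr.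
  move=> /(_ vd); rewrite fstarE.
  have := cone_minorized_gtNy (x k.+1 *m K + v) f_cone_minorized.
  case: (f _) => [e| |]// _; rewrite -EFinB !lee_fin dotDr dv (dotC (y k.+1)).
  lra.
have h5 : 0 <= c * enorm (z k.+1 - z k) ^+ 2.
  rewrite mulr_ge0 ?sqr_ge0// mulr_ge0 ?divr_ge0 ?(ltW alpha_gt0)//.
  by rewrite addr_ge0// divr_ge0 ?mulr_ge0 ?(ltW alpha_gt0) ?(ltW tau_gt0).
have h6 : 1 / 2 * (alphat - alpha) * enorm (z k.+1) ^+ 2
    <= 1 / 2 * (alphat - alpha) * lg ^+ 2.
  apply: ler_wpM2l; first by rewrite mulr_ge0// ltW.
  by rewrite ler_pXn2r ?nnegrE ?enorm_ge0// ltW.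
by rewrite /merit /rvarpi -/c; lra.
Qed.

Definition iterate k := row4 (x k.+1) (y k.+1) (z k.+1) (z k).

(** Choosing the normal vector of the projection step and the primal points of the proximal steps
    turns every block of the subgradient into differences of consecutive iterates. *)
Lemma frechet_iterate : exists2 C : R, 0 < C & forall k, (K0 <= k)%N ->
  exists2 xi, frechet_subdiff (uncurry4 vp) (iterate k) xi &
    enorm xi ^+ 2 <= C * step k.
Proof.
have [cA cA0 HA] := mulmx_bounded A^T; have [cK cK0 HK] := mulmx_bounded K^T.
have c0 : 0 <= c.
  rewrite mulr_ge0 ?divr_ge0 ?(ltW alpha_gt0)//.
  by rewrite addr_ge0// divr_ge0 ?mulr_ge0 ?(ltW alpha_gt0) ?(ltW tau_gt0).
have bhi : 0 <= betahi.
  have /andP[h1 h2] := beta_bounds 0%N; apply: le_trans (le_trans h1 h2).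
  exact: ltW.
(* [D] dominates the total coefficients of the three differences: [lphi + rho] for [x],
   [cK + betahi] for [y], and [cA + alpha + 4 * c] for [z]. The factor 3 below bounds the square of
   a sum of three terms. *)
pose D := lphi + rho + cK + betahi + cA + alpha + 4 * c.
have D0 : 0 < D.
  by rewrite /D; have := lphi_gt0; move: rho c rho_gt0 c0 alpha_gt0 => rho' c' *; lra.
exists (3 * D ^+ 2) => [|k kK]; first by rewrite mulr_gt0// exprn_gt0.
pose nx := rho *: (x k - x k.+1) - (grad phi (x k) + z k *m A^T - y k *m K^T).
have nxP x' : S x' -> dot nx (x' - x k.+1) <= 0 by exact: x_vi.
pose v1 := (grad phi (x k.+1) - grad phi (x k)) + (z k.+1 - z k) *m A^T
  - (y k.+1 - y k) *m K^T - rho *: (x k.+1 - x k).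
pose v2 := - (beta k *: (y k.+1 - y k)).
(* The concave square in [varpi] contributes [-(alphat - alpha) *: z k.+1], which combines with
   [-zdual k] to leave only [alpha] times a difference. *)
pose v3 := (alpha + 2 * c) *: (z k.+1 - z k).
pose v4 := - ((2 * c) *: (z k.+1 - z k)).
exists (row4 v1 v2 v3 v4).
  rewrite (_ : row4 v1 v2 v3 v4 = row4
    (grad phi (x k.+1) + z k.+1 *m A^T - y k.+1 *m K^T + nx)
    (ydual k - x k.+1 *m K)
    (x k.+1 *m A - zdual k + (2 * c) *: (z k.+1 - z k) - (alphat - alpha) *: z k.+1)
    ((2 * c) *: (z k - z k.+1))).
    exact: (varpi_frechet A K (z k) (ltW lphi_gt0) alpha_gt0 alphat_gt phi_diff
      phi_lip g_convex g_lsc g_cone_minorized g_esc (x_in_S k) nxP (y_esubgrad k)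
      (zdual_esubgrad kK)).
  congr row4.
  - rewrite /v1 /nx !mulmxBl.
    move: (z k.+1 *m _) (z k *m _) (y k.+1 *m _) (y k *m _) => a1 a2 a3 a4.
    move: (grad phi (x k.+1)) (grad phi (x k)) => g1 g2.
    move: (x k.+1) (x k) rho => x1 x2 rho'.
    by apply/rowP => i; rewrite !mxE; ring.
  - by rewrite /v2 /ydual [RHS]addrC addKr -scalerN opprB.
  - rewrite /v3 /zdual; move: (x k.+1 *m A) (z k.+1) (z k) c => xA z1 z2 c'.
    by apply/rowP => i; rewrite !mxE; ring.
  - by rewrite /v4 -scalerN opprB.
have X0 := enorm_ge0 (x k.+1 - x k).
have Y0 := enorm_ge0 (y k.+1 - y k).
have Z0 := enorm_ge0 (z k.+1 - z k).
have n1 : enorm v1 <= lphi * enorm (x k.+1 - x k) + cA * enorm (z k.+1 - z k)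
    + cK * enorm (y k.+1 - y k) + rho * enorm (x k.+1 - x k).
  apply: le_trans (enormB_le _ _) _; rewrite enormZ (gtr0_norm rho_gt0) lerD2r.
  apply: le_trans (enormB_le _ _) _; apply: lerD => //.
  by apply: le_trans (enormD_le _ _) _; apply: lerD.
have n2 : enorm v2 <= betahi * enorm (y k.+1 - y k).
  rewrite enormN enormZ (gtr0_norm (beta_gt0 k)) ler_wpM2r//.
  by case/andP: (beta_bounds k).
have n3 : enorm v3 <= (alpha + 2 * c) * enorm (z k.+1 - z k).
  have ac : 0 <= alpha + 2 * c by apply: addr_ge0; [exact: ltW|exact: mulr_ge0].
  by rewrite enormZ ger0_norm.
have n4 : enorm v4 <= 2 * c * enorm (z k.+1 - z k).
  have c2 : 0 <= 2 * c by exact: mulr_ge0.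
  by rewrite enormN enormZ ger0_norm.
have [_ _ _ _ hn] := enorm_row4 v1 v2 v3 v4.
have e1 : 0 <= (D - lphi - rho) * enorm (x k.+1 - x k).
  by rewrite mulr_ge0// /D; have := lphi_gt0; move: rho c c0 alpha_gt0 => rho' c' *; lra.
have e2 : 0 <= (D - cK - betahi) * enorm (y k.+1 - y k).
  by rewrite mulr_ge0// /D; have := lphi_gt0; move: rho c rho_gt0 c0 alpha_gt0 => rho' c' *; lra.
have e3 : 0 <= (D - cA - alpha - 4 * c) * enorm (z k.+1 - z k).
  by rewrite mulr_ge0// /D; have := lphi_gt0; move: rho c rho_gt0 c0 => rho' c' *; lra.
rewrite /step; move: hn n1 n2 n3 n4 e1 e2 e3 (enorm_ge0 (row4 v1 v2 v3 v4)) X0 Y0 Z0 D0.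
move: (enorm (row4 _ _ _ _)) (enorm v1) (enorm v2) (enorm v3) (enorm v4) D rho c.
move: (enorm (x k.+1 - x k)) (enorm (y k.+1 - y k)) (enorm (z k.+1 - z k)).
move=> X Y Z N N1 N2 N3 N4 D' rho' c' hn n1 n2 n3 n4 e1 e2 e3 N0 X0 Y0 Z0 D'0.
have tot : N <= D' * (X + Y + Z) by lra.
have : N ^+ 2 <= D' ^+ 2 * (X + Y + Z) ^+ 2.
  by rewrite -exprMn ler_pXn2r// nnegrE (le_trans N0).
move=> /le_trans; apply.
rewrite (_ : 3 * D' ^+ 2 * _ = D' ^+ 2 * (3 * (X ^+ 2 + Y ^+ 2 + Z ^+ 2))); last by ring.
rewrite ler_pM2l ?exprn_gt0//.
have := sqr_ge0 (X - Y); have := sqr_ge0 (Y - Z); have := sqr_ge0 (X - Z).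
nra.
Qed.


Lemma merit_nonincreasing k : (K0 <= k)%N -> merit k.+1 <= merit k.
Proof.
move=> kK; apply: le_trans (merit_step kK) _.
by rewrite gerBl mulr_ge0 ?step_ge0// ltW.
Qed.

Lemma merit_cvg : exists2 l : R, merit @ \oo --> l &
  forall k, (K0 <= k)%N -> l <= merit k.
Proof.
have [B [d [d0 Bd]]] := merit_ge.
pose m k := merit (k + K0).
have m_le k : m k.+1 <= m k by apply: merit_nonincreasing; exact: leq_addl.
have m_homo : {homo m : i j / (i <= j)%N >-> j <= i}.
  by apply/nonincreasing_seqP.
have m_lb : has_lbound (range m).
  exists B => _ [k _ <-]; apply: le_trans (Bd _ (leq_addl _ _)).
  by rewrite lerDl mulr_ge0 ?enorm_ge0// ltW.
have mc := nonincreasing_cvgn m_homo m_lb.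
exists (inf (range m)); first by rewrite -(cvg_shiftn K0).
move=> k kK; apply: (inf_lbound m_lb).
by exists (k - K0)%N => //; rewrite /m subnK.
Qed.

(** * Cluster points and the uniform KL inequality *)

Section Limit.
Context (vl : R).
Context (vl_cvg : merit @ \oo --> vl).

Lemma step_cvg0 : step @ \oo --> (0 : R).
Proof.
rewrite -(cvg_shiftS step).
have vl_cvg1 : merit k.+1 @[k --> \oo] --> vl by rewrite (cvg_shiftS merit).
apply: (@squeeze_cvgr _ _ _ _ (fun=> 0) (fun k => kappa^-1 * (merit k - merit k.+1))).
- exists K0 => // k /= kK; rewrite step_ge0/= ler_pdivlMl//.
  by have := merit_step kK; lra.
- exact: cvg_cst.
- rewrite -(mulr0 kappa^-1) -(subrr vl).
  by apply: cvgM; [exact: cvg_cst|exact: cvgB].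
Qed.

Lemma cvg0_of_sqr_le_step (u : nat -> R) : (forall k, 0 <= u k) ->
  (forall k, u k ^+ 2 <= step k) -> u @ \oo --> (0 : R).
Proof.
move=> u0 us.
apply: (@squeeze_cvgr _ _ _ _ (fun=> 0) (fun k => Num.sqrt (step k))).
- apply: nearW => k; rewrite u0/= -(ger0_norm (u0 k)) -sqrtr_sqr.
  by rewrite ler_sqrt ?step_ge0.
- exact: cvg_cst.
- rewrite -(@sqrtr0 R).
  exact: (@cvg_comp _ _ _ step (@Num.sqrt R) \oo _ _ step_cvg0 (@sqrt_continuous R 0)).
Qed.

(** Along the subsequence [ydual] and [zdual] converge, the first because the steps vanish.
    Closedness of the subdifferentials of [f] and [g] then gives the limits of [fstar] and [gstar],
    so the value of [varpi] passes to the limit. *)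
Lemma cluster_iterate (h : nat -> nat) (x0 : 'rV[R]_n) (y0 : 'rV[R]_p)
    (z0 u0 : 'rV[R]_s) :
  (forall j, (K0 <= h j)%N) -> (forall j, (j <= h j)%N) ->
  x (h j).+1 @[j --> \oo] --> x0 -> y (h j).+1 @[j --> \oo] --> y0 ->
  z (h j).+1 @[j --> \oo] --> z0 -> z (h j) @[j --> \oo] --> u0 ->
  vp x0 y0 z0 u0 = vl%:E.
Proof.
move=> hK hj cx cy cz cu.
have Sx0 : S x0.
  have cS : closed S by apply: compact_closed => //; exact: norm_hausdorff.
  apply: (closed_cvg S cS _ _ cx).
  by apply: nearW => j; exact: x_in_S.
have cq : ydual (h j) @[j --> \oo] --> x0 *m K.
  rewrite -[X in _ --> X]addr0; apply: cvgD.
    exact: (cvg_mulmx cx).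
  apply: (@cvg_squeeze0 _ _ _ _ (fun j => betahi * enorm (y (h j).+1 - y (h j)))).
    apply: nearW => j; rewrite subr0 enormZ (gtr0_norm (beta_gt0 _)) enormB.
    by rewrite ler_wpM2r ?enorm_ge0//; case/andP: (beta_bounds (h j)).
  rewrite -(mulr0 betahi); apply: cvgM; first exact: cvg_cst.
  apply: (@cvg_subseq R (fun k => enorm (y k.+1 - y k)) h _ hj).
  apply: cvg0_of_sqr_le_step => k; first exact: enorm_ge0.
  by rewrite /step addrAC lerDr addr_ge0 ?sqr_ge0.
have cp : zdual (h j) @[j --> \oo] --> x0 *m A + alpha *: u0 - alphat *: z0.
  apply: cvgB; last by apply: cvgZr.
  by apply: cvgD; [exact: (cvg_mulmx cx)|apply: cvgZr].
have [fs fsc] := esubgrad_closed f_lsc f_cone_minorized f_proper.2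
  (fun j => y_esubgrad (h j)) cy cq.
have [gs gsc] := esubgrad_closed g_lsc g_cone_minorized g_proper.2
  (fun j => zdual_esubgrad (hK j)) cz cp.
have fE : f (x0 *m K) = (fine (f (x0 *m K)))%:E by rewrite fineK//; case: fs.
have gE : g (x0 *m A + alpha *: u0 - alphat *: z0) =
  (fine (g (x0 *m A + alpha *: u0 - alphat *: z0)))%:E by rewrite fineK//; case: gs.
have vpE := @varpi_fin R n p s S f g phi A K alpha alphat x0 y0 z0 u0 _ _ Sx0
  (esubgrad_conjugate gs gE) (esubgrad_conjugate fs fE).
rewrite /vp vpE; congr EFin.
have cphi : phi (x (h j).+1) @[j --> \oo] --> phi x0.
  exact: (@cvg_comp _ _ _ (fun j => x (h j).+1) phi \oo _ _ cx
    (differentiable_continuous (phi_diff x0))).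
have czu : enorm (z (h j).+1 - z (h j)) @[j --> \oo] --> enorm (z0 - u0).
  exact: (cvg_enorm (cvgB cz cu)).
have czn : enorm (z (h j).+1) @[j --> \oo] --> enorm z0 by exact: (cvg_enorm cz).
have cg : gstar (h j) @[j --> \oo] --> dot z0 (x0 *m A + alpha *: u0 - alphat *: z0)
    - fine (g (x0 *m A + alpha *: u0 - alphat *: z0)).
  exact: (cvgB (cvg_dot cz cp) gsc).
have cf : fstar (h j) @[j --> \oo] --> dot y0 (x0 *m K) - fine (f (x0 *m K)).
  exact: (cvgB (cvg_dot cy cq) fsc).
have cm : merit (h j) @[j --> \oo] --> rvarpi phi A K alpha alphat x0 y0 z0 u0
    (dot z0 (x0 *m A + alpha *: u0 - alphat *: z0)
      - fine (g (x0 *m A + alpha *: u0 - alphat *: z0)))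
    (dot y0 (x0 *m K) - fine (f (x0 *m K))).
  have c1 : dot (z (h j).+1) (x (h j).+1 *m A) @[j --> \oo] --> dot z0 (x0 *m A).
    exact: (cvg_dot cz (cvg_mulmx cx)).
  have c2 : dot (x (h j).+1 *m K) (y (h j).+1) @[j --> \oo] --> dot (x0 *m K) y0.
    exact: (cvg_dot (cvg_mulmx cx) cy).
  have c3 : alpha / 2 * (1 + 4 * alpha / (alphat - alpha))
      * enorm (z (h j).+1 - z (h j)) ^+ 2 @[j --> \oo] -->
      alpha / 2 * (1 + 4 * alpha / (alphat - alpha)) * enorm (z0 - u0) ^+ 2.
    exact: (cvgM (cvg_cst _) (cvgM czu czu)).
  have c4 : 1 / 2 * (alphat - alpha) * enorm (z (h j).+1) ^+ 2 @[j --> \oo] -->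
      1 / 2 * (alphat - alpha) * enorm z0 ^+ 2.
    exact: (cvgM (cvg_cst (1 / 2 * (alphat - alpha))) (cvgM czn czn)).
  exact: (cvgB (cvgD (cvgD (cvgB (cvgD (cvgB c1 cg) cphi) c2) cf) c3) c4).
exact: (cvg_unique (@Rhausdorff R) cm (@cvg_subseq R merit h vl hj vl_cvg)).
Qed.

Lemma iterate_bounded : exists M : R, forall k, (K0 <= k)%N -> enorm (iterate k) <= M.
Proof.
have [X [X0 XP]] := compact_enorm_bounded S_compact.
have [B [d [d0 Bd]]] := merit_ge.
have mK k : (K0 <= k)%N -> merit k <= merit K0.
  elim: k => [|k IH]; first by rewrite leqn0 => /eqP ->.
  rewrite leq_eqVlt => /predU1P[->//|]; rewrite ltnS => kK.
  exact: le_trans (merit_nonincreasing kK) (IH kK).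
exists (X + (merit K0 - B) / d + lg + lg) => k kK.
have [_ _ _ _ h] := enorm_row4 (x k.+1) (y k.+1) (z k.+1) (z k).
apply: (le_trans h); rewrite !lerD ?z_bound ?XP//; first exact: x_in_S.
by rewrite ler_pdivlMr// mulrC; have := Bd k kK; have := mK k kK; lra.
Qed.

Lemma cvg_iterate (h : nat -> nat) x0 y0 z0 u0 :
  iterate (h j) @[j --> \oo] --> row4 x0 y0 z0 u0 ->
  [/\ x (h j).+1 @[j --> \oo] --> x0, y (h j).+1 @[j --> \oo] --> y0,
      z (h j).+1 @[j --> \oo] --> z0 & z (h j) @[j --> \oo] --> u0].
Proof.
move=> /cvg_enormP ci.
have comp j := enorm_row4 (x (h j).+1 - x0) (y (h j).+1 - y0) (z (h j).+1 - z0)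
  (z (h j) - u0).
by split; apply: (cvg_squeeze0 _ ci); apply: nearW => j;
  have := comp j; rewrite -row4B => -[].
Qed.

(** The subgradients vanish with the steps and the values converge, so 0 is a limiting subgradient;
    this puts the cluster point in the domain where KL is assumed. *)
Lemma critical_point (h : nat -> nat) (xi : nat -> 'rV[R]_(n + (p + (s + s)))) C what :
  (forall j, (K0 <= h j)%N) -> (forall j, (j <= h j)%N) ->
  (forall k, (K0 <= k)%N -> frechet_subdiff (uncurry4 vp) (iterate k) (xi k)) ->
  (forall k, (K0 <= k)%N -> enorm (xi k) ^+ 2 <= C * step k) ->
  iterate (h j) @[j --> \oo] --> what ->
  uncurry4 vp what = vl%:E /\ subdiff_domain (uncurry4 vp) what.
Proof.
move=> hK hj xiP xiC ci.
have vpw : uncurry4 vp what = vl%:E.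
  have [x0 [y0 [z0 [u0 wE]]]] := row4P what.
  rewrite wE in ci *; have [cx cy cz cu] := cvg_iterate ci.
  by rewrite uncurry4_row4; exact: (cluster_iterate hK hj cx cy cz cu).
split=> //; exists 0; split; first by rewrite vpw.
exists (iterate \o h), (xi \o h); split=> //.
- by move=> j; exact: xiP.
- rewrite vpw.
  have -> : (fun j => uncurry4 vp ((iterate \o h) j)) = (fun j => (merit (h j))%:E).
    by apply/funext => j; rewrite /= uncurry4_row4 meritE.
  apply: cvg_EFin; first by apply: nearW => j.
  exact: (@cvg_subseq R merit h vl hj vl_cvg).
- apply: (@cvg_squeeze0 _ _ _ _ (fun j => Num.sqrt (C * step (h j)))).
    apply: nearW => j; rewrite subr0 -(ger0_norm (enorm_ge0 _)) -sqrtr_sqr.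
    by rewrite ler_wsqrtr// xiC.
  rewrite -(@sqrtr0 R) -(mulr0 C).
  apply: (@cvg_comp _ _ _ (fun j => C * step (h j)) (@Num.sqrt R) \oo
     (nbhs (C * 0)) _ _ (@sqrt_continuous R (C * 0))).
  by apply: cvgM; [exact: cvg_cst|exact: (@cvg_subseq R step h 0 hj step_cvg0)].
Qed.

(* The constant [sigma] is made uniform by contradiction: violations with
   [sigma = j] would accumulate at a critical point, where the KL inequality
   holds with a fixed constant. *)
Lemma uniform_kl theta (xi : nat -> 'rV[R]_(n + (p + (s + s)))) C :
  0 <= theta < 1 ->
  (forall w, subdiff_domain (uncurry4 vp) w ->
     exists2 sigma : R, 0 < sigma &
       kl_property
         (@third_block_in R n p s (interior (effective_domain (fenchel_conjugate g))))
         (uncurry4 vp)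
         (fun t => sigma / (1 - theta) * t `^ (1 - theta)) w) ->
  (forall k, (K0 <= k)%N -> frechet_subdiff (uncurry4 vp) (iterate k) (xi k)) ->
  (forall k, (K0 <= k)%N -> enorm (xi k) ^+ 2 <= C * step k) ->
  exists (sigma : R) (N : nat), [/\ 0 < sigma, (K0 <= N)%N &
    forall k, (N <= k)%N -> vl < merit k ->
      (merit k - vl) `^ theta <= sigma * enorm (xi k)].
Proof.
move=> /andP[th0 th1] KL xiP xiC; apply: contrapT => H.
have viol j : exists k, [/\ (K0 + j <= k)%N, vl < merit k &
    j.+1%:R * enorm (xi k) < (merit k - vl) `^ theta].
  apply: contrapT => nok; apply: H; exists j.+1%:R, (K0 + j)%N.
  split=> [||k jk mk]; [by rewrite ltr0n|exact: leq_addr|].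
  by rewrite leNgt; apply/negP => lt; apply: nok; exists k.
have [kk kkP] := choice viol.
have [M MP] := iterate_bounded.
have [|what [e [eP cw]]] := @bounded_subsequence R _ M (iterate \o kk).
  move=> j; apply: MP; have [h _ _] := kkP j.
  exact: leq_trans (leq_addr _ _) h.
pose h j := kk (e j).
have hK j : (K0 <= h j)%N.
  by have [H1 _ _] := kkP (e j); exact: leq_trans (leq_addr _ _) H1.
have hj j : (j <= h j)%N.
  have [H1 _ _] := kkP (e j); apply: leq_trans H1.
  exact: leq_trans (eP j) (leq_addl _ _).
have [vpw dw] := critical_point hK hj xiP xiC cw.
have [sigma s0 [_ [eta [U [[eta0 oU Uw _ _] KLU]]]]] := KL _ dw.
have mh : merit (h j) @[j --> \oo] --> vl.
  exact: (@cvg_subseq R merit h vl hj vl_cvg).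
have nearU : \forall j \near \oo, U (iterate (h j)).
  by apply: cw; exact: open_nbhs_nbhs.
have near_eta : \forall j \near \oo, ((merit (h j))%:E < vl%:E + eta)%E.
  case: eta eta0 {KLU} => [t| |//]; last by move=> _; apply: nearW => j; rewrite ltry.
  rewrite lte_fin => t0; have : vl < vl + t by rewrite ltrDl.
  by move=> /(cvgr_lt _ mh); apply: filterS => j; rewrite -EFinD lte_fin.
have near_sig : \forall j \near \oo, sigma <= (e j).+1%:R.
  have [N _ NP] := nbhs_infty_ger sigma.
  exists N => // j Nj; apply: (le_trans (NP j Nj)).
  by rewrite ler_nat; apply: leqW.
have [j [[Uj etaj] sigj]] := @filter_ex _ _ _ _ (filterI (filterI nearU near_eta) near_sig).
have [_ mj lt] := kkP (e j); rewrite -/(h j) in mj lt.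
have vpj : uncurry4 vp (iterate (h j)) = (merit (h j))%:E.
  by rewrite uncurry4_row4 meritE.
have := KLU _ Uj; rewrite vpw vpj lte_fin => /(_ mj etaj).
have d0 : 0 < merit (h j) - vl by rewrite subr_gt0.
rewrite -EFinB/= derive1_scaled_powR// => kl.
have := powR_gt0 theta d0; rewrite powRN in kl; move: (_ `^ theta) kl lt => T kl lt T0.
(* The Frechet subgradient is a limiting one, so its norm bounds the distance in the KL inequality
   from above. *)
have dist : (edistance 0%R (limiting_subdiff (uncurry4 vp) (iterate (h j)))
    <= (enorm (xi (h j)))%:E)%E.
  apply: ereal_inf_lbound; exists (xi (h j)); last by rewrite sub0r enormN.
  by apply: frechet_limiting; exact: xiP.
have sT : 0 < sigma / T by rewrite divr_gt0.
have := le_trans kl (lee_wpmul2l _ dist); rewrite lee_fin => /(_ (ltW sT)).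
rewrite -EFinM lee_fin mulrAC ler_pdivlMr// mul1r => kl2.
have := le_trans kl2 (ler_wpM2r (enorm_ge0 _) sigj).
by rewrite leNgt lt.
Qed.

End Limit.

(** * From the KL inequality to the rates *)

Lemma convergence_rates theta :
  0 <= theta < 1 ->
  (forall w, subdiff_domain (uncurry4 vp) w ->
     exists2 sigma : R, 0 < sigma &
       kl_property
         (@third_block_in R n p s (interior (effective_domain (fenchel_conjugate g))))
         (uncurry4 vp)
         (fun t => sigma / (1 - theta) * t `^ (1 - theta)) w) ->
  let vpk k := vp (x k) (y k) (z k) (z k.-1) in
  exists vplim : R,
    [/\ vpk k @[k --> \oo] --> vplim%:E,
        (theta = 0 -> \forall k \near \oo, vpk k = vplim%:E),
        (0 < theta <= 1 / 2 ->
           exists (k0 : nat) (q kappa1 : R),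
             [/\ (K0 + 2 <= k0)%N, 0 < q < 1, 0 < kappa1
               & forall k, (k0 <= k)%N ->
                   (0 <= vpk k - vplim%:E <= (kappa1 * q ^+ k)%:E)%E])
      & (1 / 2 < theta < 1 ->
           exists (k0 : nat) (kappa2 : R),
             [/\ (K0 + 2 <= k0)%N, 0 < kappa2
               & forall k, (k0 + 1 <= k)%N ->
                   (0 <= vpk k - vplim%:E
                      <= (kappa2 * k%:R `^ (- (2 * theta - 1)^-1))%:E)%E])].
Proof.
move=> th01 KL vpk.
have [C0 C00 fr] := frechet_iterate.
have [vl vl_cvg vl_le] := merit_cvg.
have /choice[xi xiP] : forall k, exists xi, (K0 <= k)%N ->
    frechet_subdiff (uncurry4 vp) (iterate k) xi /\ enorm xi ^+ 2 <= C0 * step k.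
  move=> k; have [kK|kK] := leqP K0 k; last by exists 0.
  by have [v v1 v2] := fr k kK; exists v.
have [sigma [N [s0 KN klN]]] := uniform_kl vl_cvg th01 KL
  (fun k kK => (xiP k kK).1) (fun k kK => (xiP k kK).2).
(* The shift undoes the indexing of [merit], which is one behind the iterates; hence also the bound
   [N.+1] below. *)
pose e k := merit k.-1 - vl.
(* KL squared contributes [sigma ^+ 2], the subgradient bound [C0], and the descent inequality
   [1 / kappa]. *)
pose C := sigma ^+ 2 * C0 / kappa.
have C_gt0 : 0 < C by rewrite divr_gt0// mulr_gt0// exprn_gt0.
have vpkE k : (K0 < k)%N -> vpk k = (e k + vl)%:E.
  by case: k => // k kK; rewrite /vpk /= meritE// /e subrK.
have e_ge0 k : (N.+1 <= k)%N -> 0 <= e k.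
  by case: k => // k Nk; rewrite subr_ge0; apply: vl_le; exact: leq_trans KN Nk.
have e_cvg : e @ \oo --> (0 : R).
  have : merit k - vl @[k --> \oo] --> vl - vl by exact: (cvgB vl_cvg (cvg_cst vl)).
  by rewrite subrr => h; rewrite -(cvg_shiftS e).
have e_rec k : (N.+1 <= k)%N -> 0 < e k.+1 ->
    (e k.+1 `^ theta) ^+ 2 <= C * (e k - e k.+1).
  case: k => // k; rewrite ltnS => Nk; rewrite /e/= subr_gt0 => vm.
  have kK := leq_trans KN Nk.
  have h1 := klN k.+1 (leqW Nk) vm.
  have h2 : ((merit k.+1 - vl) `^ theta) ^+ 2 <= sigma ^+ 2 * enorm (xi k.+1) ^+ 2.
    rewrite -exprMn ler_pXn2r ?nnegrE ?powR_ge0//.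
    by rewrite mulr_ge0 ?enorm_ge0// ltW.
  have h3 := (xiP k.+1 (leqW kK)).2.
  have h4 := merit_step kK.
  apply: (le_trans h2).
  have h5 : sigma ^+ 2 * enorm (xi k.+1) ^+ 2 <= sigma ^+ 2 * (C0 * step k.+1).
    by rewrite ler_pM2l// exprn_gt0.
  apply: (le_trans h5).
  have h6 : step k.+1 <= kappa^-1 * (merit k - merit k.+1).
    by rewrite ler_pdivlMl//; lra.
  rewrite (_ : C * _ = sigma ^+ 2 * (C0 * (kappa^-1 * (merit k - merit k.+1)))).
    by rewrite !ler_pM2l ?exprn_gt0.
  by rewrite /C; move: (merit k) (merit k.+1) kappa => m m' kap; ring.
exists vl; split.
- have -> : vl%:E = (0 + vl)%:E by rewrite add0r.
  apply: (@cvg_trans _ ((e k + vl)%:E @[k --> \oo])).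
    apply: near_eq_cvg; exists K0.+1 => // k /= kK; by rewrite vpkE.
  apply: cvg_EFin; first by apply: nearW.
  exact: (cvgD e_cvg (cvg_cst vl)).
- move=> th0; have := finite_rate C_gt0 e_ge0 e_cvg e_rec th0.
  move=> [M _ MP]; exists (maxn M K0.+1) => // k /=; rewrite geq_max => /andP[Mk kK].
  by rewrite vpkE// (MP k Mk) add0r.
- move=> th; have [k0 [q [kap [h1 h2 h3 h4]]]] :=
    linear_rate C_gt0 e_ge0 e_cvg e_rec th (K0 + 2).
  exists k0, q, kap; split=> // k kk; rewrite vpkE; last first.
    by apply: leq_trans (leq_trans h1 kk); rewrite addn2.
  by rewrite -EFinB addrK !lee_fin h4.
- move=> th; have [k0 [kap [h1 h2 h3]]] :=
    sublinear_rate C_gt0 e_ge0 e_rec th (K0 + 2).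
  exists k0, kap; split=> // k; rewrite addn1 => kk; rewrite vpkE; last first.
    by apply: leq_trans (leq_trans h1 (ltnW kk)); rewrite addn2.
  by rewrite -EFinB addrK !lee_fin h3// ltnW.
Qed.

End Stabilized.
End Algorithm.

Theorem theorem6p2 (R : realType) (n p s : nat)
  (S : set 'rV[R]_n) (f : 'rV[R]_p -> \bar R) (g : 'rV[R]_s -> \bar R)
  (A : 'M[R]_(n, s)) (K : 'M[R]_(n, p)) (phi : 'rV[R]_n -> R) (lphi : R)
  (r lg : R) (gamma alpha mu eps : R)
  (betalo betahi : R) (beta : nat -> R) (a : nat -> R)
  (idx : nat -> nat) (alphas : nat -> R)
  (x : nat -> 'rV[R]_n) (y : nat -> 'rV[R]_p) (z : nat -> 'rV[R]_s)
  (S_nonempty : S !=set0) (S_convex : convex_set S) (S_compact : compact S)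
  (f_proper : proper_function f) (f_convex : econvex f)
  (f_lsc : lower_semicontinuous f)
  (g_proper : proper_function g) (g_convex : econvex g)
  (g_lsc : lower_semicontinuous g)
  (phi_diff : forall u, differentiable phi u)
  (lphi_gt0 : 0 < lphi)
  (phi_lip : forall u v, enorm (grad phi u - grad phi v) <= lphi * enorm (u - v))
  (AS_ri : [set u *m A | u in S] `<=` relative_interior (effective_domain g))
  (F_bounded : (-oo < ereal_inf [set objective g phi f A K u | u in S])%E)
  (KS_ri : [set u *m K | u in S] `<=` relative_interior (effective_domain f))
  (r_gt0 : 0 < r)
  (Kr_int : [set w | (edistance w [set u *m A | u in S] <= r%:E)%E]
            `<=` interior (effective_domain g))
  (lg_gt0 : 0 < lg)
  (g_lip : forall w w',
     (edistance w [set u *m A | u in S] <= r%:E)%E ->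
     (edistance w' [set u *m A | u in S] <= r%:E)%E ->
     (`|g w - g w'| <= (lg * enorm (w - w'))%:E)%E)
  (g_esc : essentially_strictly_convex g)
  (f_int : interior (effective_domain f) !=set0)
  (gamma_bounds : 0 < gamma <= 2 * r / lg)
  (alpha_bounds : 0 < alpha < gamma / 2)
  (mu_gt0 : 0 < mu)
  (eps_bounds : 0 < eps <= r)
  (betalo_gt0 : 0 < betalo)
  (beta_bounds : forall k, betalo <= beta k <= betahi)
  (a_ref : reference_sequence alpha gamma a)
  (z0_bound : enorm (z 0%N) <= lg)
  (dpfs : adaptive_dpfs S f g phi A K lphi alpha gamma mu eps beta a
            idx alphas x y z) :
  (exists (K0 : nat) (alphat : R), stabilized alpha eps alphas z K0 alphat) /\
  forall (K0 : nat) (alphat : R), stabilized alpha eps alphas z K0 alphat ->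
  let vp := varpi S f g phi A K alpha alphat in
  let vpk k := vp (x k) (y k) (z k) (z k.-1) in
  forall theta : R, 0 <= theta < 1 ->
  (forall w, subdiff_domain (uncurry4 vp) w ->
     exists2 sigma : R, 0 < sigma &
       kl_property
         (@third_block_in R n p s (interior (effective_domain (fenchel_conjugate g))))
         (uncurry4 vp)
         (fun t => sigma / (1 - theta) * t `^ (1 - theta)) w) ->
  exists vplim : R,
    [/\ vpk k @[k --> \oo] --> vplim%:E,
        (theta = 0 -> \forall k \near \oo, vpk k = vplim%:E),
        (0 < theta <= 1 / 2 ->
           exists (k0 : nat) (q kappa1 : R),
             [/\ (K0 + 2 <= k0)%N, 0 < q < 1, 0 < kappa1
               & forall k, (k0 <= k)%N ->
                   (0 <= vpk k - vplim%:E <= (kappa1 * q ^+ k)%:E)%E])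
      & (1 / 2 < theta < 1 ->
           exists (k0 : nat) (kappa2 : R),
             [/\ (K0 + 2 <= k0)%N, 0 < kappa2
               & forall k, (k0 + 1 <= k)%N ->
                   (0 <= vpk k - vplim%:E
                      <= (kappa2 * k%:R `^ (- (2 * theta - 1)^-1))%:E)%E])].
Proof.
have /andP[eps_gt0 _] := eps_bounds.
split.
  exact: (eventually_stabilized S_nonempty g_proper g_convex g_lsc r_gt0 Kr_int
    lg_gt0 g_lip gamma_bounds alpha_bounds eps_gt0 a_ref z0_bound dpfs).
move=> K0 alphat stab vp vpk theta th KL.
exact: (convergence_rates S_nonempty S_convex S_compact f_proper f_convex f_lsc
  g_proper g_convex g_lsc phi_diff lphi_gt0 phi_lip KS_ri r_gt0 Kr_int lg_gt0 g_lip
  g_esc f_int gamma_bounds alpha_bounds mu_gt0 betalo_gt0 beta_bounds a_ref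
  z0_bound dpfs stab th KL).
Qed.
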